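(* For any measurable space $\mathcal X$ there exists a measurable mapping $\mathcal D=\mathcal D_{\mathcal X}:\mathcal M^*(\mathcal X)\to\mathcal P^2(\mathcal X)$ such that for every $\alpha\in\mathcal M^*(\mathcal X)$, $\mathcal D(\alpha)$ is a Dirichlet measure on $\mathcal P(\mathcal X)$ parameterized by $\alpha$. Moreover, the mapping $\mathcal D$ is a natural transformation of the functor $M_*$ to the functor $P_*^2$ in the category of measurable spaces whose morphisms are measurable mappings; that is, for every measurable mapping $\kappa:\mathcal X\to\mathcal Y$ between measurable spaces, $$\mathcal D_{\mathcal Y}\circ M_*(\kappa)=P_*^2(\kappa)\circ\mathcal D_{\mathcal X}\quad\text{on }\mathcal M^*(\mathcal X).$$
   Context: For a measurable space $\mathcal X$: $\mathcal M^*(\mathcal X)$ is the set of nonzero finite nonnegative measures and $\mathcal P(\mathcal X)$ the set of probability measures on $\mathcal X$, each with the $\sigma$-algebra $\Sigma_w$, the smallest one making $\mu\mapsto\mu(A)$ measurable for all measurable $A\subset\mathcal X$. $\mathcal P^2(\mathcal X):=\mathcal P(\mathcal P(\mathcal X),\Sigma_w)$, again with its $\sigma$-algebra $\Sigma_w$. For a measurable map $\kappa:\mathcal X\to\mathcal Y$, $M_*(\kappa):\mathcal M^*(\mathcal X)\to\mathcal M^*(\mathcal Y)$ and $P_*(\kappa):\mathcal P(\mathcal X)\to\mathcal P(\mathcal Y)$ denote push-forward of measures, and $P_*^2(\kappa):=P_*(P_*(\kappa)):\mathcal P^2(\mathcal X)\to\mathcal P^2(\mathcal Y)$. $\Omega_k=\{\omega_1,\dots,\omega_k\}$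 is the finite sample space with $k$ elements (all subsets measurable), and $\Delta_k:=\mathcal P(\Omega_k)$ is the probability simplex. Dirichlet distribution: for $\alpha=(\alpha_1,\dots,\alpha_k)\in\mathcal M^*(\Omega_k)=\mathbb R^k_{\ge0}\setminus\{0\}$ let $\Omega(\alpha)=\{\omega_j:\alpha_j\neq0\}=\{\omega_{i_1},\dots,\omega_{i_l}\}$, with $l=\#\Omega(\alpha)$, and let $\pi_\alpha:\Omega(\alpha)\to\Omega_k$ be the inclusion. Then $Dir(\alpha)=Dir(\alpha_1,\dots,\alpha_k)\in\mathcal P^2(\Omega_k)$ is $P_*^2(\pi_\alpha)\,Dir(\alpha|_{\Omega(\alpha)})$, where $Dir(\alpha|_{\Omega(\alpha)})\in\mathcal P(\Delta_l)$ is the classical $(l-1)$-dimensional Dirichlet distribution, with density with respect to $(l-1)$-dimensional Lebesgue measure on the simplex $$\frac{\Gamma(\alpha_{i_1}+\dots+\alpha_{i_l})}{\Gamma(\alpha_{i_1})\cdots\Gamma(\alpha_{i_l})}\prod_{j=1}^l x_{i_j}^{\alpha_{i_j}-1},\qquad (x_{i_1},\dots,x_{i_l})\in\Delta_l$$ (for $l=1$ it is the point mass on the one-point simplex). Dirichlet measure: for $\alpha\in\mathcal M^*(\mathcal X)$, an element $\mathcal D(\alpha)\in\mathcal P^2(\mathcal X)$ is a Dirichlet measure on $\mathcal P(\mathcal X)$ parameterized by $\alpha$ if for all surjective measurable mappings $\pi_k:\mathcal X\to\Omega_k$, $$P_*^2(\pi_k)(\mathcal D(\alpha))=Dir\bigl(\alpha(\pi_k^{-1}(\omega_1)),\dots,\alpha(\pi_k^{-1}(\omega_k))\bigr)\in\mathcal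 P^2(\Omega_k).$$ *)

(* Defs.v *)
From HB Require Import structures.
From mathcomp Require Import all_boot all_order all_algebra.
From mathcomp Require Import all_classical all_reals all_analysis.
From mathcomp Require Import measurable_realfun.

Set Implicit Arguments.
Unset Strict Implicit.
Unset Printing Implicit Defensive.

Import Order.TTheory GRing.Theory Num.Theory.
Import numFieldNormedType.Exports.

Local Open Scope classical_set_scope.
Local Open Scope ring_scope.

(* 'I_n.+1 serves as the sample space with n.+1 points. *)
HB.instance Definition _ (n : nat) := isPointed.Build 'I_n.+1 ord0.
HB.instance Definition _ (n : nat) :=
  @isMeasurable.Build default_measure_display 'I_n.+1 discrete_measurable
    discrete_measurable0 discrete_measurableC discrete_measurableU.

(* Two records of measures may agree on all measurable sets and still differ as
   functions on [set X].  The sigma-algebras of Mstar and pprobability do not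
   separate such records, so a measurable map between these types is well
   defined up to agreement on measurable sets. *)
Section nonzero_finite_measures.
Context d (X : measurableType d) (R : realType).

Record nzfinite_measure := NzFiniteMeasure {
  nzfinite_val :> {finite_measure set X -> \bar R} ;
  nzfinite_neq0 : nzfinite_val [set: X] <> 0%E }.

HB.instance Definition _ := gen_eqMixin nzfinite_measure.
HB.instance Definition _ := gen_choiceMixin nzfinite_measure.

Let point_neq0 : (dirac (point : X) : set X -> \bar R) [set: X] <> 0%E.
Proof. by rewrite diracT => /eqP; rewrite onee_eq0. Qed.

HB.instance Definition _ := isPointed.Build nzfinite_measure
  (@NzFiniteMeasure (dirac (point : X)) point_neq0).

Definition nzfinite_evs : set (set nzfinite_measure) :=
  [set (fun mu : nzfinite_measure => mu U) @^-1` B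
     | U in measurable & B in measurable].

Definition Mstar : measurableType nzfinite_evs.-sigma :=
  g_sigma_algebraType nzfinite_evs.

End nonzero_finite_measures.

Section push_forward.
Context d d' (X : measurableType d) (Y : measurableType d') (R : realType).
Variable kappa : {mfun X >-> Y}.

Section finite_measure.
Variable mu : nzfinite_measure X R.

Definition nzfinite_pushforward : set Y -> \bar R := pushforward mu kappa.

Let pf0 : nzfinite_pushforward set0 = 0%E.
Proof. exact: measure0. Qed.

Let pf_ge0 A : (0 <= nzfinite_pushforward A)%E.
Proof. exact: measure_ge0. Qed.

Let pf_sigma_additive : semi_sigma_additive nzfinite_pushforward.
Proof. exact: (@measure_semi_sigma_additive _ _ _ (pushforward mu kappa)). Qed.

HB.instance Definition _ := isMeasure.Build _ _ _ nzfinite_pushforward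
  pf0 pf_ge0 pf_sigma_additive.

Let pf_fin : fin_num_fun nzfinite_pushforward.
Proof.
move=> A mA; apply: fin_num_measure.
by rewrite -[_ @^-1` _]setTI; exact: measurable_funPT.
Qed.

HB.instance Definition _ :=
  Measure_isFinite.Build _ _ _ nzfinite_pushforward pf_fin.

Let pf_neq0 : nzfinite_pushforward [set: Y] <> 0%E.
Proof. exact: (@nzfinite_neq0 _ _ _ mu). Qed.

Definition M_map : nzfinite_measure Y R := NzFiniteMeasure pf_neq0.

End finite_measure.

Definition P_map (P : pprobability X R) : pprobability Y R :=
  distribution P kappa.

Lemma measurable_P_map : measurable_fun [set: pprobability X R] P_map.
Proof.
apply: (measurability (@pset _ _ _ : set (set (pprobability Y R)))) => //.
move=> _ -[_ [r r01] [B mB <-]] <-; rewrite setTI.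
apply: sub_sigma_algebra; exists r => //.
exists (kappa @^-1` B) => //.
by rewrite -[_ @^-1` _]setTI; exact: measurable_funPT.
Qed.

HB.instance Definition _ := isMeasurableFun.Build _ _ _ _ P_map
  measurable_P_map.

End push_forward.

Definition P2_map d d' (X : measurableType d) (Y : measurableType d')
    (R : realType) (kappa : {mfun X >-> Y}) :
    pprobability (pprobability X R) R -> pprobability (pprobability Y R) R :=
  P_map (R := R) (P_map (R := R) kappa).

Section classical_dirichlet.
Context (R : realType).

Definition Gamma (s : R) : R :=
  (\int[lebesgue_measure]_(x in `]0%R, +oo[) (x `^ (s - 1) * expR (- x))).

Definition tuple_cons n (p : n.-tuple R * measurableTypeR R) : n.+1.-tuple R :=
  [tuple of p.2 :: p.1].

Lemma measurable_tuple_cons n :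
  measurable_fun [set: n.-tuple R * measurableTypeR R] (@tuple_cons n).
Proof. by apply: measurable_cons => //; exact: measurable_snd. Qed.

HB.instance Definition _ n := isMeasurableFun.Build _ _ _ _ (@tuple_cons n)
  (@measurable_tuple_cons n).

Section lebesgue_cons.
Context n (mu : {measure set (n.-tuple R) -> \bar R}).

Definition lebesgue_cons : set (n.+1.-tuple R) -> \bar R :=
  pushforward (mu \x lebesgue_measure)%E (@tuple_cons n).

Let cons0 : lebesgue_cons set0 = 0%E.
Proof. exact: measure0. Qed.

Let cons_ge0 A : (0 <= lebesgue_cons A)%E.
Proof. exact: measure_ge0. Qed.

Let cons_sigma_additive : semi_sigma_additive lebesgue_cons.
Proof. exact: (@measure_semi_sigma_additive _ _ _ (pushforward _ _)). Qed.

HB.instance Definition _ := isMeasure.Build _ _ _ lebesgue_cons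
  cons0 cons_ge0 cons_sigma_additive.

End lebesgue_cons.

Fixpoint lebesgue_tuple n : {measure set (n.-tuple R) -> \bar R} :=
  if n is m.+1 then lebesgue_cons (lebesgue_tuple m) else dirac [tuple].

(* The simplex of probability measures on 'I_n.+1 is parameterized by its first
   n coordinates; this is the normalization of n-dimensional Lebesgue measure
   on the simplex for which the density below has total mass 1. *)
Definition simplex_chart n (p : pprobability 'I_n.+1 R) : n.-tuple R :=
  [tuple fine (p [set widen_ord (leqnSn n) i]) | i < n].

(* The barycentric coordinates of the point with chart coordinates t: t_i for
   i < n, and 1 - (t_0 + ... + t_(n-1)) for i = n. *)
Definition simplex_coord n (t : n.-tuple R) (i : 'I_n.+1) : R :=
  nth (1 - \sum_(u <- t) u) t i.

Definition dirichlet_pdf n (a : 'I_n.+1 -> R) (t : n.-tuple R) : R :=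
  Gamma (\sum_i a i) / (\prod_i Gamma (a i)) *
  \prod_i simplex_coord t i `^ (a i - 1).

(* Intended for a with positive entries; for n = 0 it is the point mass. *)
Definition dirichlet_pos n (a : 'I_n.+1 -> R)
    (A : set (pprobability 'I_n.+1 R)) : \bar R :=
  (\int[lebesgue_tuple n]_(t in @simplex_chart n @` A)
     (dirichlet_pdf a t)%:E)%E.

End classical_dirichlet.

Section dirichlet.
Context (R : realType) (k : nat) (alpha : 'I_k.+1 -> R).

Definition dirichlet_supp : {set 'I_k.+1} := [set j | alpha j != 0]%SET.

(* The inclusion of the support, whose #|supp| points are listed in increasing
   order; #|supp| > 0 since alpha is nonzero, so #|supp|.-1.+1 = #|supp|. *)
Definition dirichlet_incl (i : 'I_(#|dirichlet_supp|.-1).+1) : 'I_k.+1 :=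
  nth ord0 (enum dirichlet_supp) i.

Lemma measurable_dirichlet_incl :
  measurable_fun [set: 'I_(#|dirichlet_supp|.-1).+1] dirichlet_incl.
Proof. by []. Qed.

HB.instance Definition _ := isMeasurableFun.Build _ _ _ _ dirichlet_incl
  measurable_dirichlet_incl.

(* P2_map of the inclusion, written as a bare push-forward because dirichlet_pos
   is given as a set function, like the distributions of the library. *)
Definition dirichlet : set (pprobability 'I_k.+1 R) -> \bar R :=
  pushforward (dirichlet_pos (alpha \o dirichlet_incl))
    (P_map (R := R) dirichlet_incl).

End dirichlet.

(* A map from X onto the empty sample space does not exist, X being pointed. *)
Definition is_dirichlet_measure d (X : measurableType d) (R : realType)
    (alpha : Mstar X R) (D : pprobability (pprobability X R) R) : Prop :=
  forall (k : nat) (p : {mfun X >-> 'I_k.+1}),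
    (forall j, exists x, p x = j) ->
    forall A : set (pprobability 'I_k.+1 R), measurable A ->
      P2_map p D A = dirichlet (fun j => fine (alpha (p @^-1` [set j]))) A.

(* Main.v *)
(* Fix alpha, of total mass c, and let T send the law Q of a random probability
   measure P to the law of theta * dirac x + (1 - theta) * P, where
   theta ~ Beta(1, c), x ~ alpha / c and P ~ Q are independent.  Then D alpha is
   the unique fixed point of T.

   Existence: Sethuraman's stick breaking of an i.i.d. sequence of pairs
   (theta, x).  The infinite product exists over an arbitrary measurable space
   because a decreasing sequence of cylinders whose probabilities do not tend to
   0 has a common point, chosen one coordinate at a time.
   Uniqueness: on observables that are Lipschitz for the total variation distance
   T contracts by the factor E(1 - theta) = c / (c + 1) < 1, and such observables
   determine laws on the space of probability measures.
   Naturality: push-forward along kappa intertwines the operators T of alpha and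
   of its image, so it maps fixed points to fixed points.
   Finite spaces: with unit vectors e_j, the substitution
   x = theta e_j + (1 - theta) t turns the average over theta of the density
   prod_i t_i^(a_i - 1) into x_j / a_j * prod_i x_i^(a_i - 1); weighting by a_j and
   summing over j gives back the density since sum_j x_j = 1.  Hence the classical
   Dirichlet distribution is a fixed point.  Its total mass is computed from the
   product of the Gamma integrals by scaling. *)
From HB Require Import structures.
Require Import Defs.
From mathcomp Require Import all_boot all_order all_algebra.
From mathcomp Require Import all_classical all_reals all_analysis.
From mathcomp Require Import measurable_realfun giry ring lra.

Set Implicit Arguments.
Unset Strict Implicit.
Unset Printing Implicit Defensive.

Import Order.TTheory GRing.Theory Num.Theory.
Import numFieldNormedType.Exports.

Local Open Scope classical_set_scope.
Local Open Scope ring_scope.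

(** * Countable products of a probability measure *)

(** A projective limit of the finite-dimensional Dirichlet laws would only give a random set
    function, additive almost surely along each single sequence of sets; stick breaking produces
    actual measures on an arbitrary measurable space. The fixed point equation then replaces a
    computation of their finite-dimensional distributions: naturality along a finite-valued map
    reduces these to a finite space, where uniqueness identifies two solutions. Beta(1, c) is what
    the substitution there calls for: with x = theta e_j + (1 - theta) t, the Jacobian and the
    homogeneity of the density contribute the powers -n and n + 1 - c of 1 - theta, and (1 -
    theta)^(c - 1) cancels them exactly. Two constraints shape the constructions. The map has to be
    measurable in alpha, so each ingredient is shown to depend measurably on its parameter. Measures
    are compared on measurable sets only, so equations are stated set by set and transported by the
    saturation of measurable events. Vanishing parameters are outside the scope of the density; a
    retraction onto the support leads back to positive ones. *)

Definition scons (Y : Type) (y : Y) (s : nat -> Y) : nat -> Y :=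
  fun n => if n is m.+1 then s m else y.

Section sequences.
Context d (Y : measurableType d).

Definition seq_coords : set (set (nat -> Y)) :=
  [set (fun s => s nB.1) @^-1` nB.2 | nB in [set nB : nat * set Y | measurable nB.2]].

Definition seqs : measurableType seq_coords.-sigma :=
  g_sigma_algebraType seq_coords.

Lemma measurable_coord n : measurable_fun [set: seqs] (fun s : seqs => s n).
Proof.
move=> _ B mB; rewrite setTI; apply: sub_sigma_algebra.
by exists (n, B).
Qed.

Lemma measurable_to_seqs d' (Z : measurableType d') (f : Z -> seqs) :
  (forall n, measurable_fun [set: Z] (fun z => f z n)) ->
  measurable_fun [set: Z] f.
Proof.
move=> mf; apply: (@measurability _ _ _ _ _ f seq_coords) => //.
move=> _ [_ [[n B] /= mB <-] <-]; rewrite setTI.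
by have := mf n measurableT B mB; rewrite setTI.
Qed.

Lemma measurable_scons :
  measurable_fun [set: Y * seqs] (fun z => scons z.1 z.2 : seqs).
Proof.
apply: measurable_to_seqs => -[|n] /=; first exact: measurable_fst.
apply: (measurableT_comp (measurable_coord n)); exact: measurable_snd.
Qed.

Definition scons_pair (z : Y * seqs) : seqs := scons z.1 z.2.

HB.instance Definition _ := isMeasurableFun.Build _ _ _ _ scons_pair
  measurable_scons.

Lemma measurable_scons1 y : measurable_fun [set: seqs] (scons y : seqs -> seqs).
Proof.
by have := measurableT_comp measurable_scons (pair1_measurable y).
Qed.

Lemma measurable_scons_preimage y (A : set seqs) :
  measurable A -> measurable (scons y @^-1` A : set seqs).
Proof. by move=> mA; have := measurable_scons1 y measurableT mA; rewrite setTI. Qed.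

Definition depends n (A : set (nat -> Y)) :=
  forall s t, (forall i, (i < n)%N -> s i = t i) -> A s -> A t.

Lemma depends_le n m A : (n <= m)%N -> depends n A -> depends m A.
Proof. by move=> nm nA s t st; apply: nA => i ni; apply: st; apply: leq_trans nm. Qed.

Lemma dependsC n A : depends n A -> depends n (~` A).
Proof. by move=> nA s t st As At; apply: As; apply: nA At => i /st. Qed.

Lemma dependsU n A B : depends n A -> depends n B -> depends n (A `|` B).
Proof. by move=> nA nB s t st [/(nA _ _ st)|/(nB _ _ st)]; [left|right]. Qed.

Lemma depends_scons n A y : depends n.+1 A -> depends n (scons y @^-1` A).
Proof. by move=> nA s t st; apply: nA => -[//|i] /=; exact: st. Qed.

Lemma depends0 A : depends 0 A -> A = set0 \/ A = setT.
Proof.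
move=> nA; have [->|/set0P[s As]] := eqVneq A set0; first by left.
by right; apply/seteqP; split => // t _; apply: nA As.
Qed.

Definition cylinder (A : set (nat -> Y)) :=
  measurable (A : set seqs) /\ exists n, depends n A.

Lemma cylinder0 : cylinder set0.
Proof. by split => //; exists 0%N. Qed.

Lemma cylinderC : setC_closed cylinder.
Proof.
move=> A [mA [n nA]]; split; first exact: measurableC.
by exists n; exact: dependsC.
Qed.

Lemma cylinderU : setU_closed cylinder.
Proof.
move=> A B [mA [n nA]] [mB [m mB']]; split; first exact: measurableU.
by exists (maxn n m); apply: dependsU;
  [apply: depends_le nA; exact: leq_maxl|apply: depends_le mB'; exact: leq_maxr].
Qed.

(** A second copy of the sequence space: it carries the algebra of cylinders, while [seqs] carries
    the generated sigma-algebra, and measure extension leads from the first to the second. *)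
Definition cylT : Type := nat -> Y.
HB.instance Definition _ := Pointed.on cylT.
HB.instance Definition _ := @isAlgebraOfSets.Build default_measure_display cylT
  cylinder cylinder0 cylinderU cylinderC.

End sequences.
Arguments depends {d Y}.
Arguments depends_scons {d Y n A} y.
Arguments cylinder {d Y}.

Section prefix_integral.
Context d (Y : measurableType d) (R : realType).

(** The first [n] coordinates are integrated out and the remaining ones are set to the default
    [point]. For a set that depends on [n] coordinates only, the padding does not influence the
    value, which is the product probability. *)
Fixpoint prefix_prob (nu : probability Y R) n (A : set (nat -> Y)) : \bar R :=
  if n is m.+1 then \int[nu]_y prefix_prob nu m (scons y @^-1` A)
  else (\1_A (fun=> point))%:E.

Lemma prefix_prob_ge0 nu n A : (0 <= prefix_prob nu n A)%E.
Proof.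
by elim: n A => [|n IH] A /=; [rewrite lee_fin|exact: integral_ge0].
Qed.

(** The parameter space [Z] is arbitrary because the induction step moves the first coordinate [y]
    into it: a section over [z] becomes a section over [(z, y)], and the kernel integral over [y]
    preserves measurability. *)
Lemma measurable_prefix_prob n d' (Z : measurableType d')
    (k : Z -> pprobability Y R) (mk : measurable_fun [set: Z] k)
    (A : set (Z * seqs Y)) : measurable A ->
  measurable_fun [set: Z] (fun z => prefix_prob (k z) n (xsection A z)).
Proof.
elim: n => [|n IH] in d' Z k mk A * => mA /=.
  apply/measurable_EFinP.
  rewrite (_ : (fun _ => _) = \1_A \o (fun z => (z, (fun=> point) : seqs Y))).
    apply: measurableT_comp; first exact: measurable_indic.
    exact: pair2_measurable.
  by apply/funext => z /=; rewrite !indicE mem_xsection.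
pose f (w : (Z * Y) * seqs Y) : Z * seqs Y := (w.1.1, scons w.1.2 w.2).
have mf : measurable_fun setT f.
  apply: measurable_fun_pair.
    by apply: (measurableT_comp measurable_fst); exact: measurable_fst.
  have mg : measurable_fun setT (fun w : (Z * Y) * seqs Y => (w.1.2, w.2)).
    apply: measurable_fun_pair; last exact: measurable_snd.
    by apply: (measurableT_comp measurable_snd); exact: measurable_fst.
  exact: (measurableT_comp (@measurable_scons _ Y) mg).
have mk' : measurable_fun [set: Z * Y] (k \o fst).
  by apply: measurableT_comp => //; exact: measurable_fst.
have mA' : measurable (f @^-1` A) by rewrite -[_ @^-1` _]setTI; exact: mf.
have /= := IH _ _ _ mk' _ mA'.
set g := (X in measurable_fun _ X) => mg.
have g0 z : (0 <= g z)%E by apply: prefix_prob_ge0.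
have := measurable_fun_integral_finite_kernel g (kprobability mk) g0 mg.
apply: eq_measurable_fun => z _ /=.
by apply: eq_integral => y _; rewrite /g /=; congr prefix_prob.
Qed.

Lemma measurable_prefix_prob1 (nu : probability Y R) n (A : set (seqs Y)) :
  measurable A ->
  measurable_fun [set: Y] (fun y => prefix_prob nu n (scons y @^-1` A)).
Proof.
move=> mA.
pose f (w : Y * seqs Y) : seqs Y := scons w.1 w.2.
have mA' : measurable (f @^-1` A).
  by rewrite -[_ @^-1` _]setTI; exact: measurable_scons.
have mk : measurable_fun [set: Y] (fun _ : Y => nu : pprobability Y R).
  exact: measurable_cst.
have := measurable_prefix_prob n mk mA'.
apply: eq_measurable_fun => y _ /=; congr prefix_prob.
by apply/seteqP; split => s; rewrite /xsection /= !inE.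
Qed.

Lemma prefix_probU (nu : probability Y R) n (A B : set (seqs Y)) :
  measurable A -> measurable B -> A `&` B = set0 ->
  prefix_prob nu n (A `|` B) = (prefix_prob nu n A + prefix_prob nu n B)%E.
Proof.
elim: n => [|n IH] /= in A B * => mA mB AB0.
  rewrite !indicE in_setU -EFinD; set p := fun=> point.
  have [Ap|_] := boolP (p \in A); have [Bp|_] := boolP (p \in B);
    rewrite /= ?addr0 ?add0r//.
  have : (A `&` B) p by split; apply: set_mem.
  by rewrite AB0.
rewrite -ge0_integralD//; first last.
- exact: measurable_prefix_prob1.
- by move=> y _; exact: prefix_prob_ge0.
- exact: measurable_prefix_prob1.
- by move=> y _; exact: prefix_prob_ge0.
apply: eq_integral => y _; apply: IH.
- exact: measurable_scons_preimage.
- exact: measurable_scons_preimage.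
- by rewrite -preimage_setI AB0 preimage_set0.
Qed.

Lemma prefix_prob0 (nu : probability Y R) n : prefix_prob nu n set0 = 0%E.
Proof.
elim: n => [|n IH] /=; first by rewrite indic0.
by rewrite integral0_eq// => y _; rewrite preimage_set0.
Qed.

Lemma prefix_probT (nu : probability Y R) n : prefix_prob nu n setT = 1%E.
Proof.
elim: n => [|n IH] /=; first by rewrite indicT.
under eq_integral do rewrite preimage_setT IH.
by rewrite integral_cst// mul1e; exact: probability_setT.
Qed.

(** A set depending on no coordinate is empty or full, and integrating the constants 0 and 1 against
    a probability returns them. *)
Lemma prefix_prob_depends (nu : probability Y R) n m A :
  depends n A -> (n <= m)%N -> prefix_prob nu m A = prefix_prob nu n A.
Proof.
elim: n => [|n IH] in m A *.
  by move=> /depends0[]->; rewrite ?(prefix_prob0, prefix_probT).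
move=> nA; case: m => // m nm /=; apply: eq_integral => y _.
by apply: IH => //; exact: depends_scons.
Qed.

End prefix_integral.

Section product_content.
Context d (Y : measurableType d) (R : realType) (nu : probability Y R).
Local Open Scope ereal_scope.

(** [xget] selects some number of coordinates on which [A] depends; all such numbers give the same
    value, by [prefix_prob_depends]. *)
Definition cyl_prob (A : set (cylT Y)) : \bar R :=
  prefix_prob nu (xget 0%N [set n | depends n A]) A.

Lemma cyl_probE n A : depends n A -> cyl_prob A = prefix_prob nu n A.
Proof.
move=> nA; rewrite /cyl_prob; set m := xget _ _.
have mA : depends m A by rewrite /m; case: xgetP => [//|/(_ n)].
rewrite -(prefix_prob_depends nu mA (leq_maxl m n)).
by rewrite -(prefix_prob_depends nu nA (leq_maxr m n)).
Qed.

Lemma cyl_prob_ge0 A : 0 <= cyl_prob A.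
Proof. exact: prefix_prob_ge0. Qed.

Lemma cyl_prob0 : cyl_prob set0 = 0.
Proof. exact: prefix_prob0. Qed.

Lemma cyl_probT : cyl_prob setT = 1.
Proof. exact: prefix_probT. Qed.

Lemma cyl_probU (A B : set (cylT Y)) : measurable A -> measurable B ->
  A `&` B = set0 -> cyl_prob (A `|` B) = cyl_prob A + cyl_prob B.
Proof.
move=> [mA [n nA]] [mB [m mB']] AB0.
have nA' := depends_le (leq_maxl n m) nA.
have mB'' := depends_le (leq_maxr n m) mB'.
rewrite (cyl_probE (dependsU nA' mB'')) (cyl_probE nA') (cyl_probE mB'').
exact: prefix_probU.
Qed.

Lemma cyl_prob_le1 (A : set (cylT Y)) : measurable A -> cyl_prob A <= 1.
Proof.
move=> mA; rewrite -cyl_probT -(setvU A) cyl_probU ?setICl//.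
  by rewrite leeDr// cyl_prob_ge0.
exact: measurableC.
Qed.

Lemma cyl_prob_fin (A : set (cylT Y)) : measurable A -> cyl_prob A \is a fin_num.
Proof.
move=> mA; rewrite ge0_fin_numE ?cyl_prob_ge0//.
by rewrite (le_lt_trans (cyl_prob_le1 mA)) ?ltry.
Qed.

Lemma cylinder_scons y (A : set (cylT Y)) :
  measurable A -> measurable (scons y @^-1` A : set (cylT Y)).
Proof.
move=> [mA [n nA]]; split; first exact: measurable_scons_preimage.
by exists n; apply: depends_scons; exact: depends_le nA.
Qed.

Lemma cyl_prob_scons (A : set (cylT Y)) : measurable A ->
  cyl_prob A = \int[nu]_y cyl_prob (scons y @^-1` A).
Proof.
move=> [mA [n nA]]; have nA' := depends_le (leqnSn n) nA.
rewrite (cyl_probE nA') /=; apply: eq_integral => y _.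
by rewrite -(cyl_probE (depends_scons y nA')).
Qed.

Lemma measurable_cyl_prob_scons (A : set (cylT Y)) : measurable A ->
  measurable_fun [set: Y] (fun y => cyl_prob (scons y @^-1` A)).
Proof.
move=> [mA [n nA]].
apply: eq_measurable_fun (measurable_prefix_prob1 nu n mA) => y _.
by rewrite (cyl_probE (depends_scons y (depends_le (leqnSn n) nA))).
Qed.

(** Dominated convergence with bound 1. The contrapositive selects a coordinate: if the
    probabilities do not tend to 0, neither do those of the sections at some [y]. *)
Lemma cyl_prob_cvg0_scons (A : nat -> set (cylT Y)) :
  (forall n, measurable (A n)) ->
  (forall y, cyl_prob (scons y @^-1` A n) @[n --> \oo] --> 0) ->
  cyl_prob (A n) @[n --> \oo] --> 0.
Proof.
move=> mA Ay0.
under eq_fun do rewrite cyl_prob_scons//.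
have [] := @dominated_convergence _ _ _ nu setT measurableT
  (fun n y => cyl_prob (scons y @^-1` A n)) (cst 0) (cst 1).
- by move=> n; exact: measurable_cyl_prob_scons.
- exact: measurable_cst.
- by apply: aeW => y _; exact: Ay0.
- exact: finite_measure_integrable_cst.
- apply: aeW => y n _ /=; rewrite gee0_abs ?cyl_prob_ge0//.
  exact/cyl_prob_le1/cylinder_scons.
- by move=> _ _; rewrite integral0.
Qed.

Lemma cyl_prob_cvg0 (A : nat -> set (cylT Y)) :
  (forall n, measurable (A n)) -> (forall n, A n.+1 `<=` A n) ->
  \bigcap_n A n = set0 -> cyl_prob (A n) @[n --> \oo] --> 0.
Proof.
move=> mA ndA A0; apply: contrapT => nA.
pose good (B : nat -> set (cylT Y)) := [/\ forall n, measurable (B n),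
  forall n, B n.+1 `<=` B n & ~ (cyl_prob (B n) @[n --> \oo] --> 0)].
have step B : exists y, good B -> good (fun n => scons y @^-1` B n).
  have [[mB ndB nB]|] := pselect (good B); last by move=> nB; exists point.
  have [y By] : exists y, ~ (cyl_prob (scons y @^-1` B n) @[n --> \oo] --> 0).
    by apply/existsNP => H; apply: nB; exact: cyl_prob_cvg0_scons.
  exists y => _; split=> // n; first exact: cylinder_scons.
  by apply: preimage_subset.
have [f fP] := choice step.
(* [B k n] is the section of [A n] at the first [k] chosen coordinates; [s] below lists all the
   choices. *)
pose B := fix B k := if k is j.+1 then fun n => scons (f (B j)) @^-1` B j n else A.
have gB k : good (B k) by elim: k => [//|k IH]; exact: fP.
pose s k := f (B k).
have sB k n : A n s <-> B k n (fun i => s (k + i)%N).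
  elim: k => [|k ->]; first by [].
  rewrite [B k.+1 n _]/= (_ : scons _ _ = fun i => s (k + i)%N)//.
  by apply/funext => -[|i] /=; rewrite ?addn0// addnS.
suff : (\bigcap_n A n) s by rewrite A0.
move=> n _; apply: contrapT => nAs.
have [_ [N NA]] := mA n.
have dB k : depends (N - k) (B k n).
  elim: k => [|k IH]; first by rewrite subn0.
  apply: depends_scons; apply: depends_le IH.
  by rewrite subnS; exact: leqSpred.
(* After [N] choices the section of [A n] depends on no coordinate, so it is empty or full, and full
   would put [s] in [A n]. By monotonicity all later sections are empty too, against the fact that
   their probabilities do not tend to 0. *)
have BNn0 : B N n = set0.
  have := dB N; rewrite subnn => /depends0[//|BT].
  by exfalso; apply: nAs; apply/(sB N); rewrite BT.
have B0 m : (n <= m)%N -> B N m = set0.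
  elim: m => [|m IH]; first by rewrite leqn0 => /eqP <-.
  rewrite leq_eqVlt => /predU1P[<-//|/IH BNm0].
  by apply/seteqP; split => // x; rewrite -BNm0; have [_ + _] := gB N; exact.
have [_ _] := gB N; apply; apply: cvg_near_cst; exists n => // m /= nm.
by rewrite B0// cyl_prob0.
Qed.

(** Continuity at the empty set, applied to the remainders [G n] of the union after removal of its
    first [n] pieces. *)
Let premeasure_sigma_additive : semi_sigma_additive cyl_prob.
Proof.
move=> F mF tF mUF.
pose G := fix G n := if n is m.+1 then G m `\` F m else \bigcup_n F n.
have mG n : measurable (G n).
  by elim: n => [//|n IH]; apply: measurableD.
have GP n x : G n x <-> (\bigcup_n F n) x /\ forall i, (i < n)%N -> ~ F i x.
  elim: n => [|n IH] /=; first by split=> [|[]].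
  split=> [[/IH[Fx nF] nFx]|[Fx nF]].
    by split=> // i; rewrite ltnS leq_eqVlt => /predU1P[->//|]; exact: nF.
  by split; [apply/IH; split => // i ni; apply: nF; exact: leqW|exact: nF].
have FG n : F n `<=` G n.
  move=> x Fx; apply/GP; split; first by exists n.
  move=> i ni Fix; suff : i = n by move=> ein; move: ni; rewrite ein ltnn.
  by apply: tF => //; exists x.
have GS n : cyl_prob (G n) = cyl_prob (F n) + cyl_prob (G n.+1).
  rewrite -cyl_probU//.
  - by congr cyl_prob; rewrite /= setDE setUIr setUv setIT setUC setUidl//.
  - by rewrite /= setDE setICA setICr setI0.
have sumE n : \sum_(0 <= i < n) cyl_prob (F i) =
    cyl_prob (\bigcup_n F n) - cyl_prob (G n).
  elim: n => [|n IH].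
    by rewrite big_nil /= subee// cyl_prob_fin.
  rewrite big_nat_recr//= IH GS oppeD ?fin_num_adde_defl ?cyl_prob_fin//.
  rewrite -addeA; congr (_ + _).
  by rewrite addeAC [X in X - _]addeC subee ?cyl_prob_fin// add0e.
under eq_fun do rewrite sumE.
have -> : nbhs (cyl_prob (\bigcup_n F n)) = nbhs (cyl_prob (\bigcup_n F n) - 0).
  by rewrite sube0.
apply: cvgeB => //.
- by rewrite fin_num_adde_defl.
- exact: cvg_cst.
apply: cyl_prob_cvg0 => //.
- by move=> n x [].
apply/seteqP; split => // x Gx.
have [[i _ Fix] _] := (GP 0%N x).1 (Gx 0%N I).
by have [_ /(_ i (ltnSn i))] := (GP i.+1 x).1 (Gx i.+1 I).
Qed.

HB.instance Definition _ := isMeasure.Build _ _ _ cyl_prob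
  cyl_prob0 cyl_prob_ge0 premeasure_sigma_additive.

End product_content.

Section product_probability.
Context d (Y : measurableType d) (R : realType).
Local Open Scope ereal_scope.

Lemma coord_cylinder n (B : set Y) : measurable B ->
  cylinder ((fun s => s n) @^-1` B).
Proof.
move=> mB; split.
  by have := measurable_coord n measurableT mB; rewrite setTI.
by exists n.+1 => s t st; rewrite /= (st n).
Qed.

Lemma seqs_measurableE : @measurable _ (seqs Y) = <<s @cylinder _ Y >>.
Proof.
apply/seteqP; split.
  apply: smallest_sub; first exact: smallest_sigma_algebra.
  move=> _ [[n B] /= mB <-]; apply: sub_sigma_algebra.
  exact: coord_cylinder.
apply: smallest_sub; first exact: sigma_algebra_measurable.
by move=> A [].
Qed.

Section fixed_factor.
Variable nu : probability Y R.

Definition seq_prob (A : set (seqs Y)) : \bar R := measure_extension (cyl_prob nu) A.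

Let seq_prob0 : seq_prob set0 = 0.
Proof. exact: (measure0 (measure_extension (cyl_prob nu))). Qed.

Let seq_prob_ge0 A : 0 <= seq_prob A.
Proof. exact: (measure_ge0 (measure_extension (cyl_prob nu))). Qed.

Let seq_prob_sigma_additive : semi_sigma_additive seq_prob.
Proof.
move=> F mF tF mUF.
apply: (@measure_semi_sigma_additive _ _ _ (measure_extension (cyl_prob nu))) => //.
  by move=> i; move: (mF i); rewrite seqs_measurableE.
by move: mUF; rewrite seqs_measurableE.
Qed.

HB.instance Definition _ := isMeasure.Build _ _ _ seq_prob
  seq_prob0 seq_prob_ge0 seq_prob_sigma_additive.

Lemma seq_probE (A : set (seqs Y)) : cylinder A -> seq_prob A = cyl_prob nu A.
Proof. by move=> cA; rewrite /seq_prob /measure_extension measurable_mu_extE. Qed.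

Let seq_probT : seq_prob setT = 1.
Proof.
rewrite seq_probE ?cyl_probT//.
by rewrite -setC0; apply: cylinderC; exact: cylinder0.
Qed.

HB.instance Definition _ :=
  Measure_isProbability.Build _ _ _ seq_prob seq_probT.

Lemma cylinderI : setI_closed (@cylinder _ Y).
Proof. by move=> A B cA cB; exact: (@measurableI _ (cylT Y)). Qed.

(** Prepending an independent coordinate of law [nu] preserves the product law: the two measures
    agree on cylinders, which generate and are stable under intersection. The fixed point equation
    of stick breaking rests on this. *)
Lemma seq_prob_scons (A : set (seqs Y)) : measurable A ->
  seq_prob A = \int[nu]_y seq_prob (scons y @^-1` A).
Proof.
move=> mA.
pose m := pushforward (nu \x seq_prob) (@scons_pair _ Y).
have mE (B : set (seqs Y)) :
    measurable B -> m B = \int[nu]_y seq_prob (scons y @^-1` B).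
  move=> mB; rewrite /m /pushforward /product_measure1.
  apply: eq_integral => y _ /=; congr seq_prob.
  by apply/seteqP; split => s; rewrite /xsection /= inE.
rewrite -mE//.
apply: (@measure_unique _ _ (seqs Y) (@cylinder _ Y) (fun=> setT)) => //.
- exact: seqs_measurableE.
- exact: cylinderI.
- by move=> _; exact: (@measurableT _ (cylT Y)).
- exact: bigcup_const.
- move=> B cB; rewrite [RHS]mE; last by case: cB.
  rewrite -[LHS]/(seq_prob B) seq_probE// cyl_prob_scons//.
  apply: eq_integral => y _.
  by rewrite seq_probE//; exact: cylinder_scons.
- by move=> _; rewrite [X in X < _](_ : _ = 1) ?ltry//; exact: probability_setT.
Qed.

End fixed_factor.

(** On cylinders this is [measurable_prefix_prob]; Dynkin induction extends it to all events. *)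
Lemma measurable_seq_prob d' (Z : measurableType d') (k : Z -> pprobability Y R)
    (A : set (seqs Y)) : measurable_fun [set: Z] k -> measurable A ->
  measurable_fun [set: Z] (fun z => seq_prob (k z) A).
Proof.
move=> mk mA.
have := mA; rewrite seqs_measurableE.
apply: (@dynkin_induction _ (seqs Y) (@cylinder _ Y)
  (fun A => measurable_fun [set: Z] (fun z => seq_prob (k z) A))).
- exact: seqs_measurableE.
- exact: cylinderI.
- under eq_fun do rewrite probability_setT; exact: measurable_cst.
- move=> B cB; have [mB [n nB]] := cB.
  have mB' : measurable (setT `*` B : set (Z * seqs Y)) by exact: measurableX.
  apply: eq_measurable_fun (measurable_prefix_prob n mk mB') => z _.
  rewrite seq_probE// (cyl_probE _ nB); congr prefix_prob.
  by apply/seteqP; split => s; rewrite /xsection /= inE /setX /=; tauto.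
- move=> B mB HB.
  under eq_fun do rewrite probability_setC//.
  by apply: emeasurable_funB => //; exact: measurable_cst.
- move=> F mF tF HF.
  apply: (eq_measurable_fun (fun z => \sum_(0 <= i <oo) seq_prob (k z) (F i))).
    by move=> z _; rewrite measure_semi_bigcup//; exact: bigcup_measurable.
  exact: ge0_emeasurable_sum.
Qed.

End product_probability.

(** * Stick breaking *)

Section pprobability_lemmas.
Context d (X : measurableType d) (R : realType).

Lemma measurable_pprobability_ev (A : set X) : measurable A ->
  measurable_fun [set: pprobability X R] (fun P : pprobability X R => P A).
Proof.
move=> mA.
exact: (measurable_kernel (kprobability (@measurable_id _ (pprobability X R) setT))).
Qed.

Lemma measurable_to_pprobability d' (Z : measurableType d')
    (f : Z -> pprobability X R) :
  (forall A, measurable A -> measurable_fun [set: Z] (fun z => f z A)) ->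
  measurable_fun [set: Z] f.
Proof.
move=> mf; apply: (measurability (@pset _ _ _ : set (set (pprobability X R)))) => //.
move=> _ -[_ [r r01] [A mA <-]] <-.
apply: emeasurable_fun_infty_o => //; exact: mf.
Qed.

(** Substitute for extensionality: events are generated by values on measurable sets, so they cannot
    separate measures that agree there. Quantifying over both [P] and [Q] makes the property
    symmetric, whence closure under complement. *)
Lemma pprobability_saturated (U : set (pprobability X R)) (P Q : pprobability X R) :
  measurable U -> (forall A, measurable A -> P A = Q A) -> U P -> U Q.
Proof.
move=> mU; move: P Q; move: U mU.
pose G := [set U : set (pprobability X R) | forall P Q : pprobability X R,
  (forall A, measurable A -> P A = Q A) -> U P -> U Q].
suff : @measurable _ (pprobability X R) `<=` G by [].
apply: smallest_sub.
  split => /=.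
  - by [].
  - move=> U GU P Q PQ /= [_ UP]; split => // UQ; apply: UP.
    by apply: GU UQ => A mA; rewrite PQ.
  - by move=> F GF P Q PQ [n _ FP]; exists n => //; exact: GF FP.
move=> _ [r r01 [A mA <-]] P Q PQ; rewrite /mset /=.
by rewrite PQ.
Qed.

End pprobability_lemmas.

Section clip.
Context (R : realType).

(** Stick lengths range over all reals, so that [mix] is a probability for every pair; [base_law] is
    concentrated on lengths in ]0, 1[, where [clip] is the identity. *)
Definition clip (t : R) : R := Num.max 0 (Num.min 1 t).

Lemma clip_ge0 t : 0 <= clip t.
Proof. by rewrite /clip le_max lexx. Qed.

Lemma clip_le1 t : clip t <= 1.
Proof. by rewrite /clip ge_max ler01 ge_min lexx. Qed.

Lemma onem_clip_ge0 t : 0 <= 1 - clip t.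
Proof. by rewrite subr_ge0 clip_le1. Qed.

Lemma clip_id t : 0 <= t <= 1 -> clip t = t.
Proof.
move=> /andP[t0 t1]; rewrite /clip; have -> : Num.min 1 t = t by apply/min_idPr.
exact/max_idPr.
Qed.

Lemma measurable_clip : measurable_fun [set: R] clip.
Proof. by apply: measurable_maxr => //; apply: measurable_minr. Qed.

End clip.

Section mix.
Context d (X : measurableType d) (R : realType).
Local Open Scope ereal_scope.

Definition mix (y : measurableTypeR R * X) (P : pprobability X R) :
    set X -> \bar R :=
  measure_add (mscale (NngNum (clip_ge0 y.1)) (dirac y.2))
              (mscale (NngNum (onem_clip_ge0 y.1)) P).

HB.instance Definition _ y P := Measure.on (mix y P).

Lemma mixE y P A :
  mix y P A = (clip y.1)%:E * \d_(y.2) A + (1 - clip y.1)%:E * P A.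
Proof. by rewrite /mix measure_addE. Qed.

Let mixT y P : mix y P setT = 1.
Proof.
by rewrite mixE diracT probability_setT !mule1 -EFinD addrC subrK.
Qed.

HB.instance Definition _ y P :=
  Measure_isProbability.Build _ _ _ (mix y P) (mixT y P).

Definition pmix (yP : (measurableTypeR R * X) * pprobability X R) :
  pprobability X R := mix yP.1 yP.2.

Lemma measurable_pmix : measurable_fun setT pmix.
Proof.
apply: measurable_to_pprobability => A mA.
apply: (eq_measurable_fun (fun yP : (measurableTypeR R * X) * pprobability X R =>
  (clip yP.1.1)%:E * \d_(yP.1.2) A + (1 - clip yP.1.1)%:E * yP.2 A)).
  by move=> yP _; rewrite -mixE.
have mclip : measurable_fun setT
    (fun yP : (measurableTypeR R * X) * pprobability X R => clip yP.1.1).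
  apply: (measurableT_comp (@measurable_clip R)).
  by apply: (measurableT_comp measurable_fst); exact: measurable_fst.
apply: emeasurable_funD; apply: emeasurable_funM.
- exact/measurable_EFinP.
- apply: (measurableT_comp (measurable_fun_dirac mA)).
  by apply: (measurableT_comp measurable_snd); exact: measurable_fst.
- by apply/measurable_EFinP; apply: measurable_funB.
- apply: (measurableT_comp (measurable_pprobability_ev mA)).
  exact: measurable_snd.
Qed.

HB.instance Definition _ :=
  isMeasurableFun.Build _ _ _ _ pmix measurable_pmix.

End mix.

Section stick_breaking.
Context d (X : measurableType d) (R : realType).
Local Open Scope ereal_scope.
Notation RX := (measurableTypeR R * X)%type.
Implicit Type s : nat -> RX.

Definition stick_weight s n : R :=
  (clip (s n).1 * \prod_(i < n) (1 - clip (s i).1))%R.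

Lemma stick_weight_ge0 s n : (0 <= stick_weight s n)%R.
Proof.
by rewrite mulr_ge0 ?clip_ge0// prodr_ge0// => i _; exact: onem_clip_ge0.
Qed.

Definition stick_mass s : \bar R := \sum_(0 <= n <oo) (stick_weight s n)%:E.

Lemma stick_mass_ge0 s : 0 <= stick_mass s.
Proof. by apply: nneseries_ge0 => n _ _; rewrite lee_fin stick_weight_ge0. Qed.

(** Telescoping: each stick takes its fraction of what the previous ones left. *)
Lemma sum_stick_weight s n :
  (\sum_(0 <= i < n) stick_weight s i = 1 - \prod_(i < n) (1 - clip (s i).1))%R.
Proof.
elim: n => [|n IH]; first by rewrite big_nil big_ord0 subrr.
by rewrite big_nat_recr//= IH big_ord_recr /= /stick_weight; ring.
Qed.

Lemma stick_mass_le1 s : stick_mass s <= 1.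
Proof.
apply: lime_le; first by apply: is_cvg_nneseries => n _ _; rewrite lee_fin stick_weight_ge0.
apply: nearW => n; rewrite sumEFin lee_fin sum_stick_weight gerBl.
by apply: prodr_ge0 => i _; exact: onem_clip_ge0.
Qed.

Lemma stick_mass_fin s : stick_mass s \is a fin_num.
Proof.
rewrite ge0_fin_numE ?stick_mass_ge0//.
by rewrite (le_lt_trans (stick_mass_le1 s)) ?ltry.
Qed.

(** The mass that no stick takes. [stick] places it at [point], so that it is a probability for
    every sequence and not only almost surely. *)
Definition stick_rem s : R := (1 - fine (stick_mass s))%R.

Lemma stick_rem_ge0 s : (0 <= stick_rem s)%R.
Proof.
by rewrite /stick_rem subr_ge0 -lee_fin fineK ?stick_mass_fin// stick_mass_le1.
Qed.

Lemma nneseries_recl_shift (f : nat -> \bar R) : (forall n, 0 <= f n) ->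
  \sum_(0 <= n <oo) f n = f 0%N + \sum_(0 <= n <oo) f n.+1.
Proof.
move=> f0; rewrite nneseries_recl//; congr (_ + _).
rewrite -(nneseries_addn 1)//; apply: eq_eseriesr => i _.
by rewrite addn1.
Qed.

Lemma stick_weight_scons0 y s : stick_weight (scons y s) 0 = clip y.1.
Proof. by rewrite /stick_weight big_ord0 mulr1. Qed.

Lemma stick_weight_sconsS y s n :
  stick_weight (scons y s) n.+1 = ((1 - clip y.1) * stick_weight s n)%R.
Proof. by rewrite /stick_weight big_ord_recl /=; ring. Qed.

Lemma stick_rem_scons y s :
  stick_rem (scons y s) = ((1 - clip y.1) * stick_rem s)%R.
Proof.
rewrite /stick_rem {1}/stick_mass nneseries_recl_shift; last first.
  by move=> n; rewrite lee_fin stick_weight_ge0.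
rewrite stick_weight_scons0.
under eq_eseriesr do rewrite stick_weight_sconsS EFinM.
rewrite nneseriesZl; last by move=> n _; rewrite lee_fin stick_weight_ge0.
rewrite -/(stick_mass s) -(fineK (stick_mass_fin s)) /=.
by ring.
Qed.

Definition stick s : set X -> \bar R :=
  measure_add
    (mseries (fun n => mscale (NngNum (stick_weight_ge0 s n)) (dirac (s n).2)) 0)
    (mscale (NngNum (stick_rem_ge0 s)) (dirac (point : X))).

HB.instance Definition _ s := Measure.on (stick s).

Lemma stickE s A : stick s A =
  \sum_(0 <= n <oo) (stick_weight s n)%:E * \d_((s n).2) A +
  (stick_rem s)%:E * \d_(point : X) A.
Proof. by rewrite /stick measure_addE. Qed.

Let stickT s : stick s setT = 1.
Proof.
rewrite stickE; under eq_eseriesr do rewrite diracT mule1.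
by rewrite diracT mule1 -/(stick_mass s) -(fineK (stick_mass_fin s)) -EFinD addrC subrK.
Qed.

HB.instance Definition _ s :=
  Measure_isProbability.Build _ _ _ (stick s) (stickT s).

(** Valid for every sequence, since a prepended stick multiplies the later weights and the leftover
    alike by one minus its length. *)
Lemma stick_scons y s A :
  stick (scons y s) A = (clip y.1)%:E * \d_(y.2) A + (1 - clip y.1)%:E * stick s A.
Proof.
rewrite !stickE nneseries_recl_shift; last first.
  by move=> n; rewrite mule_ge0 ?lee_fin ?stick_weight_ge0// ltW.
rewrite stick_weight_scons0 -addeA; congr (_ + _).
under eq_eseriesr do rewrite stick_weight_sconsS EFinM -muleA.
rewrite nneseriesZl; last by move=> n _; rewrite mule_ge0 ?lee_fin ?stick_weight_ge0//.
rewrite stick_rem_scons EFinM -muleA ge0_muleDr//.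
- by apply: nneseries_ge0 => n _ _; rewrite mule_ge0 ?lee_fin ?stick_weight_ge0.
- by rewrite mule_ge0 ?lee_fin ?stick_rem_ge0.
Qed.

Definition pstick (s : seqs RX) : pprobability X R := stick s.

Lemma measurable_stick_weight n :
  measurable_fun [set: seqs RX] (fun s : seqs RX => stick_weight s n).
Proof.
have mclip i : measurable_fun [set: seqs RX] (fun s : seqs RX => clip (s i).1).
  apply: (measurableT_comp (@measurable_clip R)).
  by apply: (measurableT_comp measurable_fst); exact: measurable_coord.
apply: measurable_funM => //; apply: measurable_prod => i _.
exact: measurable_funB.
Qed.

Lemma measurable_pstick : measurable_fun setT pstick.
Proof.
apply: measurable_to_pprobability => A mA.
apply: (eq_measurable_fun (fun s : seqs RX =>
  \sum_(0 <= n <oo) (stick_weight s n)%:E * \d_((s n).2) A +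
  (stick_rem s)%:E * \d_(point : X) A)).
  by move=> s _; rewrite -stickE.
apply: emeasurable_funD; last apply: emeasurable_funM => //.
- apply: ge0_emeasurable_sum => [n s _ _|n _].
    by rewrite mule_ge0 ?lee_fin ?stick_weight_ge0.
  apply: emeasurable_funM.
    by apply/measurable_EFinP; exact: measurable_stick_weight.
  apply: (measurableT_comp (measurable_fun_dirac mA)).
  by apply: (measurableT_comp measurable_snd); exact: measurable_coord.
- apply/measurable_EFinP; apply: measurable_funB => //.
  apply: measurableT_comp => //.
  apply: ge0_emeasurable_sum => [n s _ _|n _].
    by rewrite lee_fin stick_weight_ge0.
  by apply/measurable_EFinP; exact: measurable_stick_weight.
Qed.

HB.instance Definition _ :=
  isMeasurableFun.Build _ _ _ _ pstick measurable_pstick.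

End stick_breaking.

Section fixed_point.
Context d (X : measurableType d) (R : realType).
Local Open Scope ereal_scope.
Notation RX := (measurableTypeR R * X)%type.
Implicit Type nu : probability RX R.

Definition stick_fixpoint nu (Q : pprobability (pprobability X R) R) :=
  forall U : set (pprobability X R), measurable U ->
    Q U = \int[nu]_y Q [set P | U (mix y P : pprobability X R)].

Definition stick_law nu : pprobability (pprobability X R) R :=
  distribution (seq_prob nu) (@pstick _ X R).

(** The pathwise recursion [stick_scons] is averaged by means of [seq_prob_scons]. The two random
    measures agree only set by set, so the events are compared by saturation. *)
Lemma stick_lawP nu : stick_fixpoint nu (stick_law nu).
Proof.
move=> U mU.
have mU' : measurable (@pstick _ X R @^-1` U).
  by rewrite -[_ @^-1` _]setTI; exact: measurable_pstick.
rewrite [LHS](seq_prob_scons nu mU').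
apply: eq_integral => y _; rewrite /= /distribution /pushforward /=.
have stickmix s A : (pstick (scons y s) : pprobability X R) A =
    (mix y (pstick s) : pprobability X R) A.
  by rewrite [RHS]mixE; exact: stick_scons.
congr seq_prob; apply/seteqP; split => s /=.
  by apply: pprobability_saturated => // A _; exact: stickmix.
by apply: pprobability_saturated => // A _; exact/esym/stickmix.
Qed.

Lemma measurable_stick_law d' (Z : measurableType d') (k : Z -> pprobability RX R) :
  measurable_fun [set: Z] k -> measurable_fun [set: Z] (fun z => stick_law (k z)).
Proof.
move=> mk; apply: measurable_to_pprobability => U mU.
apply: measurable_seq_prob => //.
by rewrite -[_ @^-1` _]setTI; exact: measurable_pstick.
Qed.

End fixed_point.

(** * One-dimensional integrals *)

Section affine_change_of_variable.
Context (R : realType).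
Local Open Scope ereal_scope.
Notation leb := (@lebesgue_measure R).

Definition affine (r b : R) : measurableTypeR R -> measurableTypeR R :=
  fun x => (r * x + b)%R.

Lemma measurable_affine r b : measurable_fun setT (affine r b).
Proof. by apply: measurable_funD => //; apply: measurable_funM. Qed.

HB.instance Definition _ r b := isMeasurableFun.Build _ _ _ _ (affine r b)
  (measurable_affine r b).

Lemma lebesgue_measure_affine (r b : R) (A : set R) : (0 < r)%R -> measurable A ->
  pushforward leb (affine r b) A = (r^-1)%:E * leb A.
Proof.
move=> r0 mA.
have r1 : (0 <= r^-1)%R by rewrite invr_ge0 ltW.
pose m0 := mscale (NngNum (ltW r0)) (pushforward leb (affine r b)).
pose m : {measure set (measurableTypeR R) -> \bar R} := m0 (measurable_affine r b).
have -> : leb A = m A.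
  apply: lebesgue_measure_unique mA => X [[u v] _ <-].
  rewrite [RHS](_ : _ = r%:E * leb (affine r b @^-1` `]u, v]))//.
  rewrite [affine r b @^-1` _](_ : _ =
      `](r^-1 * (u - b))%R, (r^-1 * (v - b))%R]%classic); last first.
  apply/seteqP; split => x; rewrite /= !in_itv /= /affine;
    by rewrite ltr_pdivrMl// ler_pdivlMl// ltrBlDr lerBrDr.
  rewrite !lebesgue_measure_itv /= !lte_fin ltr_pM2l ?invr_gt0// ltrD2r.
  case: ifPn => uv; last by rewrite mule0.
  by rewrite -!EFinB -EFinM -mulrBr mulrA divff ?gt_eqF// mul1r; congr EFin; ring.
by rewrite /m /m0 /mscale /= muleA -EFinM mulVf ?gt_eqF// mul1e.
Qed.

Lemma ge0_integral_affine (r b : R) (f : R -> \bar R) : (0 < r)%R ->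
  measurable_fun setT f -> (forall x, 0 <= f x) ->
  \int[leb]_x f (r * x + b)%R = (r^-1)%:E * \int[leb]_x f x.
Proof.
move=> r0 mf f0; have r1 : (0 <= r^-1)%R by rewrite invr_ge0 ltW.
transitivity (\int[pushforward leb (affine r b)]_x f x).
  by rewrite ge0_integral_pushforward.
transitivity (\int[mscale (NngNum r1) leb]_x f x).
  by apply: eq_measure_integral => A mA _; exact: lebesgue_measure_affine.
by rewrite ge0_integral_mscale.
Qed.

Lemma ge0_integral_shift (b : R) (f : R -> \bar R) :
  measurable_fun setT f -> (forall x, 0 <= f x) ->
  \int[leb]_x f (x - b)%R = \int[leb]_x f x.
Proof.
move=> mf f0; rewrite -[RHS]mul1e -[X in X%:E * _]invr1.
rewrite -(@ge0_integral_affine 1 (- b))//.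
by apply: eq_integral => x _; rewrite mul1r.
Qed.

Lemma ge0_integral_reflect (b : R) (f : R -> \bar R) :
  measurable_fun setT f -> (forall x, 0 <= f x) ->
  \int[leb]_x f (b - x)%R = \int[leb]_x f x.
Proof.
move=> mf f0; rewrite -[RHS](@ge0_integral_shift (- b))//.
have mg : measurable_fun setT (fun x : R => f (x - - b)%R).
  by apply: measurableT_comp => //; exact: measurable_funB.
transitivity (\int[pushforward leb (-%R : R -> measurableTypeR R)]_x f (x - - b)%R).
  rewrite ge0_integral_pushforward//.
  by apply: eq_integral => x _ /=; congr f; ring.
by apply: eq_measure_integral => A mA _; exact: lebesgue_measureN.
Qed.

End affine_change_of_variable.

Section power.
Context (R : realType).
Local Open Scope ereal_scope.
Notation leb := (@lebesgue_measure R).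

(* Vanishing on the negative axis makes the density built from it vanish outside
   the closed simplex. *)
Definition pospow (s x : R) : R := (if 0 <= x then x `^ (s - 1) else 0)%R.

Lemma pospow_ge0 s x : (0 <= pospow s x)%R.
Proof. by rewrite /pospow; case: ifP => // _; exact: powR_ge0. Qed.

Lemma measurable_pospow s : measurable_fun setT (pospow s).
Proof.
have -> : pospow s = (fun x : R => \1_(`[0%R, +oo[%classic) x * x `^ (s - 1))%R.
  apply/funext => x; rewrite indicE mem_setE in_itv /= andbT /pospow.
  by case: ifP => _; rewrite ?mul1r ?mul0r.
by apply: measurable_funM; [exact: measurable_indic|exact: measurable_powR].
Qed.

Lemma pospow_mulr s x : (0 < s)%R -> (x * pospow s x = pospow (s + 1) x)%R.
Proof.
move=> s0; rewrite /pospow; case: ifPn => x0; last by rewrite mulr0.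
by rewrite mulr_powRB1// addrK.
Qed.

Lemma pospowM s r x : (0 < r)%R -> (pospow s (r * x) = r `^ (s - 1) * pospow s x)%R.
Proof.
move=> r0; rewrite /pospow pmulr_rge0//; case: ifPn => x0; last by rewrite mulr0.
by rewrite powRM// ltW.
Qed.

(** The integrand may blow up at 0, so the fundamental theorem of calculus is applied on compact
    intervals away from 0, followed by a limit on both sides. *)
Lemma integral_powR (a x : R) : (0 < a)%R -> (0 < x)%R ->
  \int[leb]_(t in `]0%R, x]) (t `^ (a - 1))%:E = (x `^ a / a)%:E.
Proof.
move=> a0 x0.
(* With [n.+2] the left end is strictly below [x] for every [n], as the fundamental theorem
   requires. *)
pose F n := `[(x / n.+2%:R)%R, x]%classic.
have xn n : (0 < x / n.+2%:R)%R by rewrite divr_gt0.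
have UF : \bigcup_n F n = `]0%R, x]%classic.
  apply/seteqP; split=> [t [n _]|t]; rewrite /F /= !in_itv /=.
    by move=> /andP[tn ->]; rewrite (lt_le_trans (xn n) tn).
  move=> /andP[t0 tx].
  exists (Num.truncn (x / t)) => //; rewrite /F /= in_itv /= tx andbT.
  rewrite ler_pdivrMr// mulrC -ler_pdivrMr//; apply/ltW.
  have /andP[_ /lt_le_trans->//] := truncn_itv (ltW (divr_gt0 x0 t0)).
  by rewrite ler_nat.
have cvg1 : \int[leb]_(t in F i) (t `^ (a - 1))%:E @[i --> \oo] -->
    \int[leb]_(t in `]0%R, x]) (t `^ (a - 1))%:E.
  rewrite -UF; apply: ge0_nondecreasing_set_cvg_integral => //.
  - apply/nondecreasing_seqP => n; rewrite subsetEset => t; rewrite /F /= !in_itv /=.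
    move=> /andP[xt ->]; rewrite andbT (le_trans _ xt)//.
    by rewrite ler_pM2l// lef_pV2 ?posrE// ler_nat.
  - move=> i; exact: measurable_itv.
  - by move=> i; apply/measurable_EFinP/measurable_funTS; exact: measurable_powR.
  - by move=> i t _; rewrite lee_fin powR_ge0.
have cvg2 : \int[leb]_(t in F i) (t `^ (a - 1))%:E @[i --> \oo] --> (x `^ a / a)%:E.
  have FE n : \int[leb]_(t in F n) (t `^ (a - 1))%:E =
      (x `^ a / a - (x / n.+2%:R) `^ a / a)%:E.
    have dpow (t : R) : (0 < t)%R ->
        is_derive t 1%R (fun t : R => t `^ a / a)%R (t `^ (a - 1))%R.
      move=> t0; have d1 := is_derive1_powR a t0.
      have d2 : is_derive t 1%R (fun t : R => t `^ a / a)%R _ :=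
        is_deriveM d1 (is_derive_cst a^-1%R t 1%R).
      apply: (is_derive_eq d2); rewrite scaler0 add0r /= /GRing.scale /=.
      by rewrite mulrA mulVf ?gt_eqF// mul1r.
    rewrite EFinB /F; apply: (@continuous_FTC2 _ _ (fun t : R => t `^ a / a)%R).
    - by rewrite ltr_pdivrMr// ltr_pMr// ltr1n.
    - apply: continuous_in_subspaceT => t; rewrite inE /= in_itv /= => /andP[ut _].
      apply/differentiable_continuous/derivable1_diffP/derivable_powR.
      by rewrite in_itv /= andbT (lt_le_trans (xn n)).
    - split.
      + move=> t; rewrite in_itv /= => /andP[ut _].
        by have [] := dpow _ (lt_trans (xn n) ut).
      + apply: cvg_at_right_filter; have [dF _] := dpow _ (xn n).
        have cF := differentiable_continuous ((derivable1_diffP _ _).1 dF).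
        exact: cF.
      + apply: cvg_at_left_filter; have [dF _] := dpow _ x0.
        exact: (differentiable_continuous ((derivable1_diffP _ _).1 dF)).
    - move=> t; rewrite in_itv /= => /andP[ut _]; rewrite derive1E.
      by have [_ ->] := dpow _ (lt_trans (xn n) ut).
  under eq_fun do rewrite FE.
  apply: cvg_EFin; first exact: nearW.
  have -> : nbhs (x `^ a / a)%R = nbhs (x `^ a / a - 0 / a)%R by rewrite mul0r subr0.
  apply: cvgB; first exact: cvg_cst.
  apply: cvgMr_tmp; apply: (cvg_at_rightP _ _ _).1 (powR_cvg0 a0) _ _; split => //.
  have -> : nbhs (0 : R)%R = nbhs (x * 0)%R by rewrite mulr0.
  apply: cvgMl_tmp.
  by have := @cvg_harmonic R; rewrite -cvg_shiftS.
exact: (cvg_unique _ cvg1 cvg2).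
Qed.

(** Serves three times: for the mass of the stick density, for the mean of 1 - theta, and for the
    integration over theta in the Dirichlet identity. As [x <= 1], the support [t <= x] of the
    integrand is not cut at 1; for [x <= 0] both sides vanish. *)
Lemma integral_pospow_sub (a x : R) : (0 < a)%R -> (x <= 1)%R ->
  \int[leb]_(t in `]0%R, 1%R[) (pospow a (x - t))%:E = (pospow (a + 1) x / a)%:E.
Proof.
move=> a0 x1.
have mp : measurable_fun setT (fun t : R => (pospow a (x - t))%:E).
  apply/measurable_EFinP; apply: (measurableT_comp (measurable_pospow a)).
  exact: measurable_funB.
rewrite integral_itv_bndo_bndc; last exact: measurable_funTS.
rewrite integral_mkcond -(ge0_integral_reflect x); last 2 first.
- exact/(measurable_restrictT _ _).1/measurable_funTS.
- by apply: erestrict_ge0 => t _; rewrite lee_fin pospow_ge0.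
have [x0|x0] := leP x 0%R.
  rewrite integral0_eq => [|t _].
    rewrite /pospow; case: ifPn => [x0'|_]; last by rewrite mul0r.
    have -> : x = 0%R by apply/le_anti/andP.
    by rewrite addrK powR0 ?mul0r// gt_eqF.
  rewrite patchE mem_setE in_itv /= subKr; case: ifPn => // /andP[xt _].
  rewrite /pospow ifF//; apply/negbTE; rewrite -ltNge.
  by rewrite (lt_le_trans _ x0)// -subr_gt0.
rewrite /pospow ltW// addrK -integral_powR//.
rewrite -integral_itv_bndo_bndc; last first.
  by apply/measurable_EFinP/measurable_funTS; exact: measurable_powR.
rewrite integral_itv_obnd_cbnd; last first.
  by apply/measurable_EFinP/measurable_funTS; exact: measurable_powR.
rewrite [RHS]integral_mkcond; apply: eq_integral => t _.
rewrite !patchE !mem_setE !in_itv /= subKr subr_gt0 lerBlDr.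
case: (leP 0%R t) => t0 /=; last by case: ifP.
by rewrite (le_trans x1) ?lerDl// andbT.
Qed.

End power.

Section gamma.
Context (R : realType).
Local Open Scope ereal_scope.
Notation leb := (@lebesgue_measure R).

(** The Gamma integral with values in the extended reals, which can pass through Tonelli before its
    finiteness is known. *)
Definition eGamma (s : R) : \bar R :=
  \int[leb]_x (pospow s x * expR (- x))%:E.

Lemma eGammaE s : eGamma s = \int[leb]_(x in `]0%R, +oo[) (x `^ (s - 1) * expR (- x))%:E.
Proof.
have mf : measurable_fun setT (fun x : R => (x `^ (s - 1) * expR (- x))%:E).
  apply/measurable_EFinP/measurable_funM; first exact: measurable_powR.
  by apply: measurableT_comp => //; exact: measurable_expR.
rewrite integral_itv_obnd_cbnd; last exact: measurable_funTS.
rewrite [RHS]integral_mkcond; apply: eq_integral => x _.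
rewrite patchE mem_setE in_itv /= andbT /pospow.
by case: ifPn => //; rewrite mul0r.
Qed.

(** On ]0, 1] the power dominates the integrand; beyond 1 half of the exponential decay absorbs the
    power, leaving a multiple of the exponential density of rate 1/2. *)
Lemma eGamma_lty (s : R) : (0 < s)%R -> eGamma s < +oo.
Proof.
move=> s0; rewrite eGammaE.
have mf : measurable_fun setT (fun x : R => (x `^ (s - 1) * expR (- x))%:E).
  apply/measurable_EFinP/measurable_funM; first exact: measurable_powR.
  by apply: measurableT_comp => //; exact: measurable_expR.
have f0 (x : R) : 0 <= (x `^ (s - 1) * expR (- x))%:E.
  by rewrite lee_fin mulr_ge0 ?powR_ge0// expR_ge0.
rewrite (_ : `]0%R, +oo[%classic = `]0%R, 1%R] `|` `]1%R, +oo[); last first.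
  by rewrite -itv_bndbnd_setU// bnd_simp.
rewrite ge0_integral_setU//=; last 2 first.
- exact: measurable_funTS.
- apply/disj_setPS => x [] /=; rewrite !in_itv /= andbT => /andP[_ x1].
  by rewrite ltNge x1.
apply: lte_add_pinfty.
  apply: (@le_lt_trans _ _ (\int[leb]_(x in `]0%R, 1%R]) (x `^ (s - 1))%:E)).
    apply: ge0_le_integral => //.
    - exact: measurable_funTS.
    - by apply/measurable_EFinP/measurable_funTS; exact: measurable_powR.
    - move=> x; rewrite /= in_itv /= => /andP[x0 _].
      by rewrite lee_fin ler_piMr ?powR_ge0// -expR0 ler_expR oppr_le0 ltW.
  by rewrite integral_powR// ltry.
(* From ln x <= x / m + ln m, this [m] gives |s - 1| ln x <= x / 2 + |s - 1| ln m. The factor 2 in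
   [K] cancels the rate of the exponential density. *)
pose m := (2 * (`|s - 1| + 1))%R.
have m0 : (0 < m)%R by rewrite mulr_gt0// ltr_wpDl.
pose K := (2 * expR (`|s - 1| * ln m))%R.
have K0 : (0 <= K)%R by rewrite mulr_ge0// expR_ge0.
apply: (@le_lt_trans _ _ (\int[leb]_x (K%:E * (exponential_pdf 2^-1 x)%:E))).
  apply: (@le_trans _ _ (\int[leb]_(x in `]1%R, +oo[) (K%:E * (exponential_pdf 2^-1 x)%:E))).
    apply: ge0_le_integral => //.
    - exact: measurable_funTS.
    - apply/measurable_funTS/measurable_funeM/measurable_EFinP.
      exact: measurable_exponential_pdf.
    - move=> x; rewrite /= in_itv /= andbT => x1.
      have x0 : (0 < x)%R by exact: lt_trans x1.
      rewrite -EFinM lee_fin (exponential_pdfE _ (ltW x0)) /K.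
      rewrite (_ : 2 * _ * _ = expR (`|s - 1| * ln m) * expR (- 2^-1 * x))%R; last by field.
      rewrite /powR gt_eqF// -!expRD.
rewrite ler_expR.
      have lnx : (ln x <= x / m + ln m)%R.
        rewrite -[X in ln X](divfK (lt0r_neq0 m0)) lnM ?posrE ?divr_gt0//.
        by rewrite lerD2r ltW// ln_sublinear// divr_gt0.
      have lnx0 : (0 <= ln x)%R by rewrite ln_ge0// ltW.
      have sm : (`|s - 1| * (x / m) <= x / 2)%R.
        rewrite mulrCA ler_pM2l// /m invfM mulrCA ler_piMr ?invr_ge0//.
        by rewrite ler_pdivrMr ?mul1r ?lerDl// ltr_wpDl.
      have := ler_wpM2r lnx0 (ler_norm (s - 1)%R).
      have := ler_wpM2l (normr_ge0 (s - 1)%R) lnx.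
      lra.
  apply: ge0_subset_integral => //.
  - by apply/measurable_funeM/measurable_EFinP; exact: measurable_exponential_pdf.
  - by move=> x _; rewrite mule_ge0// lee_fin exponential_pdf_ge0.
rewrite ge0_integralZl//; last 2 first.
- by apply/measurable_EFinP; exact: measurable_exponential_pdf.
- by move=> x _; rewrite lee_fin exponential_pdf_ge0.
by rewrite integral_exponential_pdf// mule1 ltry.
Qed.

Lemma eGamma_gt0 (s : R) : (0 < s)%R -> 0 < eGamma s.
Proof.
move=> s0; rewrite eGammaE.
have mf : measurable_fun setT (fun x : R => (x `^ (s - 1) * expR (- x))%:E).
  apply/measurable_EFinP/measurable_funM; first exact: measurable_powR.
  by apply: measurableT_comp => //; exact: measurable_expR.
have f0 (x : R) : 0 <= (x `^ (s - 1) * expR (- x))%:E.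
  by rewrite lee_fin mulr_ge0 ?powR_ge0// expR_ge0.
(* A lower bound of the integrand on [1, 2], where 0 <= ln x <= 2 and x <= 2. *)
pose e := expR (- (`|s - 1| * 2 + 2))%R : R.
apply: (@lt_le_trans _ _ (\int[leb]_(x in `[1%R, 2%R]) e%:E)).
  have leb12 : leb `[1%R, 2%R] = 1.
    by rewrite lebesgue_measure_itv /= lte_fin ltr1n -EFinB; congr EFin; ring.
  by rewrite integral_cst// [X in _ * X]leb12 mule1 lte_fin expR_gt0.
apply: (@le_trans _ _ (\int[leb]_(x in `[1%R, 2%R]) (x `^ (s - 1) * expR (- x))%:E)).
  apply: ge0_le_integral => //.
  - by move=> x _; rewrite lee_fin expR_ge0.
  - exact: measurable_funTS.
  - move=> x; rewrite /= in_itv /= => /andP[x1 x2].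
    have x0 : (0 < x)%R by exact: lt_le_trans x1.
    rewrite lee_fin /powR gt_eqF// -expRD ler_expR.
    have lnx0 : (0 <= ln x)%R by rewrite ln_ge0.
    have lnx2 : (ln x <= 2)%R by rewrite (le_trans (ltW (ln_sublinear x0))).
    have := ler_wpM2r lnx0 (lerNnormlW (lexx `|s - 1|%R)).
    have := ler_wpM2l (normr_ge0 (s - 1)%R) lnx2.
    lra.
apply: ge0_subset_integral => //; first exact: measurable_funTS.
by move=> x; rewrite /= !in_itv /= andbT => /andP[x1 _]; exact: lt_le_trans x1.
Qed.

Lemma GammaE (s : R) : Gamma s = fine (eGamma s).
Proof. by rewrite eGammaE. Qed.

Lemma eGammaEFin (s : R) : (0 < s)%R -> eGamma s = (Gamma s)%:E.
Proof.
move=> s0; rewrite GammaE fineK// ge0_fin_numE ?eGamma_lty//.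
exact/ltW/eGamma_gt0.
Qed.

Lemma Gamma_gt0 (s : R) : (0 < s)%R -> (0 < Gamma s)%R.
Proof. by move=> s0; rewrite -lte_fin -eGammaEFin// eGamma_gt0. Qed.

End gamma.

(** * The law of a stick *)

Section density_measure.
Context d (T : measurableType d) (R : realType).
Local Open Scope ereal_scope.
Variables (mu : {measure set T -> \bar R}) (w : T -> R).
Hypotheses (mw : measurable_fun [set: T] w) (w0 : forall t, (0 <= w t)%R).

(** The two proofs are arguments, so that the measure structure can be inferred from the term
    itself. *)
Definition density_measure of measurable_fun [set: T] w & (forall t, (0 <= w t)%R) :=
  fun A : set T => \int[mu]_(t in A) (w t)%:E.

Let density_measure0 : density_measure mw w0 set0 = 0.
Proof. exact: integral_set0. Qed.

Let density_measure_ge0 A : 0 <= density_measure mw w0 A.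
Proof. by apply: integral_ge0 => t _; rewrite lee_fin. Qed.

Let density_measure_sigma_additive : semi_sigma_additive (density_measure mw w0).
Proof.
move=> F mF tF mUF; rewrite /density_measure ge0_integral_bigcup//.
- by apply: is_cvg_ereal_nneg_natsum_cond => n _ _; exact: density_measure_ge0.
- by apply/measurable_EFinP/measurable_funTS.
- by move=> t _; rewrite lee_fin.
Qed.

HB.instance Definition _ := isMeasure.Build _ _ _ (density_measure mw w0)
  density_measure0 density_measure_ge0 density_measure_sigma_additive.

Import HBNNSimple.

Lemma ge0_integral_density (f : T -> \bar R) :
  measurable_fun setT f -> (forall t, 0 <= f t) ->
  \int[density_measure mw w0]_t f t = \int[mu]_t ((w t)%:E * f t).
Proof.
move=> mf f0; pose f_ := nnsfun_approx measurableT mf.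
have md : measurable_fun setT (fun t : T => (w t)%:E).
  exact/measurable_EFinP.
transitivity (limn (fun n => \int[density_measure mw w0]_t (f_ n t)%:E)).
  rewrite -monotone_convergence//.
  - by apply: eq_integral => t _; apply/esym/cvg_lim => //; exact: cvg_nnsfun_approx.
  - by move=> n; exact/measurable_EFinP/measurable_funTS.
  - by move=> *; rewrite lee_fin.
  - by move=> t _ m n mn; rewrite lee_fin; exact/lefP/nd_nnsfun_approx.
transitivity (limn (fun n => \int[mu]_t ((w t)%:E * (f_ n t)%:E))); last first.
  rewrite -monotone_convergence//.
  - apply: eq_integral => t _; apply/cvg_lim => //.
    by apply: cvgeZl => //; exact: cvg_nnsfun_approx.
  - by move=> n; apply: emeasurable_funM => //; exact/measurable_EFinP/measurable_funTS.
  - by move=> *; rewrite mule_ge0// lee_fin// w0.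
  - move=> t _ m n mn; apply: lee_wpmul2l; first by rewrite lee_fin w0.
    by rewrite lee_fin; exact/lefP/nd_nnsfun_approx.
apply: congr_lim; apply/funext => n.
rewrite integralT_nnsfun sintegralE.
transitivity (\int[mu]_t \sum_(r \in range (f_ n))
    (r%:E * ((w t)%:E * (\1_(f_ n @^-1` [set r]) t)%:E))); last first.
  apply: eq_integral => t _; rewrite [in RHS]fimfunE -fsumEFin// ge0_mule_fsumr//.
    by apply: eq_fsbigr => r _; rewrite [in RHS](EFinM r) [RHS]muleCA.
  by move=> r; rewrite nnfun_muleindic_ge0.
have m1 r : measurable_fun setT
    (fun t : T => (w t)%:E * (\1_(f_ n @^-1` [set r]) t)%:E).
  apply: emeasurable_funM; first exact: md.
  apply/measurable_EFinP; apply: measurable_indic.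
  rewrite -[X in measurable X]setTI.
  by apply: (@measurable_funPT _ _ _ _ (f_ n)) => //.
have d1 r (t : T) : 0 <= (w t)%:E * (\1_(f_ n @^-1` [set r]) t)%:E.
  by rewrite mule_ge0// lee_fin ?w0.
rewrite ge0_integral_fsum//; last 2 first.
- by move=> r; exact: measurable_funeM.
- move=> r t _; have [r0|r0] := leP 0%R r; first by rewrite mule_ge0.
  by rewrite preimage_nnfun0// indic0 !mule0.
apply: eq_fsbigr => r _; have [r0|r0] := leP 0%R r; last first.
  rewrite preimage_nnfun0// measure0 mule0 integral0_eq// => t _.
  by rewrite indic0 !mule0.
rewrite ge0_integralZl//; congr (_ * _).
transitivity (\int[mu]_(t in f_ n @^-1` [set r]) (w t)%:E) => //.
rewrite [LHS]integral_mkcond; apply: eq_integral => t _.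
by rewrite patchE indicE; case: ifP => _; rewrite ?mule1 ?mule0.
Qed.

End density_measure.

Section stick_density.
Context (R : realType).
Local Open Scope ereal_scope.
Notation leb := (@lebesgue_measure R).

(** The density of Beta(1, c) without its constant c, hence of mass 1/c. In exponential form its
    joint measurability in [c] and [t] follows by composition. *)
Definition stick_density (c t : R) : R :=
  (\1_(`]0%R, 1%R[%classic) t * expR ((c - 1) * ln (1 - t)))%R.

Lemma stick_density_ge0 c t : (0 <= stick_density c t)%R.
Proof. by rewrite mulr_ge0// expR_ge0. Qed.

Lemma stick_densityE c t :
  stick_density c t = (\1_(`]0%R, 1%R[%classic) t * pospow c (1 - t))%R.
Proof.
rewrite /stick_density indicE mem_setE in_itv /=.
have [/andP[t0 t1]|_] := boolP (0 < t < 1)%R; last by rewrite !mul0r.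
rewrite /pospow subr_ge0 ltW//.
by rewrite /powR subr_eq0 gt_eqF.
Qed.

Lemma measurable_stick_density :
  measurable_fun [set: R * R] (fun ct : R * R => stick_density ct.1 ct.2).
Proof.
apply: measurable_funM.
  apply: (measurableT_comp (f := \1_(`]0%R, 1%R[%classic) : R -> R)).
    exact: measurable_indic.
  exact: measurable_snd.
apply: (measurableT_comp (@measurable_expR R)); apply: measurable_funM.
  by apply: measurable_funB => //; exact: measurable_fst.
by apply: (measurableT_comp (@measurable_ln R)); apply: measurable_funB.
Qed.

Lemma measurable_stick_density1 c : measurable_fun [set: R] (stick_density c).
Proof. exact: (measurableT_comp measurable_stick_density (pair1_measurable c)). Qed.

Definition stick_measure (c : R) : {measure set (measurableTypeR R) -> \bar R} :=
  density_measure leb (measurable_stick_density1 c) (stick_density_ge0 c).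

Lemma stick_measureT (c : R) : (0 < c)%R -> stick_measure c setT = (c^-1)%:E.
Proof.
move=> c0; have := integral_pospow_sub c0 (lexx 1%R).
rewrite {2}/pospow ler01 addrK powR1 mul1r => <-.
rewrite /stick_measure /= /density_measure [RHS]integral_mkcond; apply: eq_integral => t _.
rewrite stick_densityE patchE indicE.
by case: ifP => _; rewrite ?mul1r ?mul0r.
Qed.

End stick_density.

Lemma ge0_integral_mnormalize d (T : measurableType d) (R : realType)
    (mu : {measure set T -> \bar R}) (P : probability T R) (f : T -> \bar R) :
  mu setT != 0%E -> mu setT \is a fin_num ->
  measurable_fun setT f -> (forall x, (0 <= f x)%E) ->
  (\int[mnormalize mu P]_x f x = (fine (mu setT))^-1%:E * \int[mu]_x f x)%E.
Proof.
move=> mu0 mufin mf f0.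
have r0 : (0 <= (fine (mu setT))^-1)%R by rewrite invr_ge0 fine_ge0.
transitivity (\int[mscale (NngNum r0) mu]_x f x)%E.
  apply: eq_measure_integral => A mA _; rewrite -[LHS]/(mnormalize mu P A).
  rewrite /mnormalize /mscale /=.
  rewrite ifF; first by rewrite muleC.
  apply/negbTE; rewrite negb_or; move: mufin; rewrite fin_numE => /andP[_ ->].
  by rewrite andbT.
by rewrite ge0_integral_mscale.
Qed.

Section base_law.
Context d (X : measurableType d) (R : realType).
Local Open Scope ereal_scope.
Notation leb := (@lebesgue_measure R).
Notation RX := (measurableTypeR R * X)%type.
Implicit Type alpha : Mstar X R.

Definition total_mass alpha : R := fine (alpha setT).

Lemma total_massE alpha : alpha setT = (total_mass alpha)%:E.
Proof. by rewrite /total_mass fineK// fin_num_measure. Qed.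

Lemma total_mass_gt0 alpha : (0 < total_mass alpha)%R.
Proof.
rewrite lt_neqAle fine_ge0// andbT eq_sym; apply/eqP => a0.
by have := @nzfinite_neq0 _ _ _ alpha; rewrite total_massE a0.
Qed.

Lemma measurable_Mstar_ev (A : set X) : measurable A ->
  measurable_fun [set: Mstar X R] (fun alpha : Mstar X R => alpha A).
Proof.
move=> mA _ B mB; rewrite setTI; apply: sub_sigma_algebra.
by exists A => //; exists B.
Qed.

Lemma measurable_total_mass : measurable_fun [set: Mstar X R] total_mass.
Proof. by apply: measurableT_comp => //; exact: measurable_Mstar_ev. Qed.

Let Mstar_measure (alpha : Mstar X R) : {measure set X -> \bar R} := alpha.

HB.instance Definition _ := isKernel.Build _ _ _ _ _ Mstar_measure
  measurable_Mstar_ev.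

Let stick_kernel (alpha : Mstar X R) : {measure set (measurableTypeR R) -> \bar R} :=
  stick_measure (total_mass alpha).

Let measurable_stick_kernel A : measurable A ->
  measurable_fun [set: Mstar X R] (stick_kernel ^~ A).
Proof.
move=> mA.
pose g (w : Mstar X R * measurableTypeR R) :=
  (stick_density (total_mass w.1) w.2)%:E * (\1_A w.2)%:E.
have mg : measurable_fun setT g.
  apply: emeasurable_funM; apply/measurable_EFinP.
    have mp : measurable_fun setT
        (fun w : Mstar X R * measurableTypeR R => (total_mass w.1, w.2)).
      apply: measurable_fun_pair; last exact: measurable_snd.
      by apply: (measurableT_comp measurable_total_mass); exact: measurable_fst.
    exact: (measurableT_comp (@measurable_stick_density R) mp).
  apply: (measurableT_comp (f := \1_A : measurableTypeR R -> R)).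
    exact: measurable_indic.
  exact: measurable_snd.
have g0 w : 0 <= g w by rewrite mule_ge0 ?lee_fin ?stick_density_ge0.
have := @measurable_fun_fubini_tonelli_F _ _ _ _ _ leb g mg g0.
apply: eq_measurable_fun => alpha _.
transitivity (\int[leb]_(t in A) (stick_density (total_mass alpha) t)%:E) => //.
rewrite [RHS]integral_mkcond; apply: eq_integral => t _.
by rewrite /g patchE indicE; case: ifP => _; rewrite ?mule1 ?mule0.
Qed.

HB.instance Definition _ := isKernel.Build _ _ _ _ _ stick_kernel
  measurable_stick_kernel.

Definition stick_part alpha : pprobability (measurableTypeR R) R :=
  mnormalize (stick_measure (total_mass alpha)) point.

Definition mean_part alpha : pprobability X R := mnormalize alpha point.

Lemma measurable_stick_part : measurable_fun [set: Mstar X R] stick_part.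
Proof. exact: (measurable_fun_mnormalize stick_kernel). Qed.

Lemma measurable_mean_part : measurable_fun [set: Mstar X R] mean_part.
Proof. exact: (measurable_fun_mnormalize Mstar_measure). Qed.

Definition base_law alpha : set RX -> \bar R := stick_part alpha \x mean_part alpha.

HB.instance Definition _ alpha := Measure.on (base_law alpha).

Let base_lawT alpha : base_law alpha setT = 1.
Proof.
have p1 : stick_part alpha setT = 1 := probability_setT (mnormalize _ _).
have p2 : mean_part alpha setT = 1 := probability_setT (mnormalize _ _).
rewrite /base_law -setXTT product_measure1E//.
by rewrite [X in X * _]p1 [X in _ * X]p2 mule1.
Qed.

HB.instance Definition _ alpha :=
  Measure_isProbability.Build _ _ _ (base_law alpha) (base_lawT alpha).

Definition pbase_law alpha : pprobability RX R := base_law alpha.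

(** Measurability of a product measure in its two factors comes from the product map of the Giry
    monad. *)
Lemma measurable_pbase_law : measurable_fun [set: Mstar X R] pbase_law.
Proof.
have mgiry d' (T : measurableType d') (k : Mstar X R -> pprobability T R) :
    measurable_fun [set: Mstar X R] k ->
    measurable_fun [set: Mstar X R] (fun alpha => k alpha : giry T R).
  move=> mk; apply: measurable_giry_codensity => // B mB.
  exact: (measurableT_comp (measurable_pprobability_ev mB) mk).
apply: measurable_to_pprobability => A mA.
have m2 := measurable_fun_pair (mgiry _ _ _ measurable_stick_part) (mgiry _ _ _ measurable_mean_part).
have := measurableT_comp (measurable_giry_ev mA) (measurableT_comp measurable_giry_prod m2).
by apply: eq_measurable_fun.
Qed.

(** The two normalizations cancel: the stick density has mass 1/c and [alpha] has mass c.
    Integration is thus against [alpha] itself, which makes the parameters a_j appear as weights on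
    finite spaces. *)
Lemma ge0_integral_base_law alpha (F : RX -> \bar R) :
  measurable_fun setT F -> (forall y, 0 <= F y) ->
  \int[base_law alpha]_y F y =
  \int[leb]_t ((stick_density (total_mass alpha) t)%:E * \int[alpha]_x F (t, x)).
Proof.
move=> mF F0; have c0 := total_mass_gt0 alpha; set c := total_mass alpha.
have mFx t : measurable_fun setT (fun x => F (t, x)).
  exact: measurableT_comp (pair1_measurable t).
have mI : measurable_fun setT (fun t : measurableTypeR R => \int[alpha]_x F (t, x)).
  exact: (@measurable_fun_fubini_tonelli_F _ _ _ _ _ alpha F mF F0).
rewrite fubini_tonelli1//.
under eq_integral => t _.
  rewrite /fubini_F ge0_integral_mnormalize//; last 2 first.
    by rewrite [X in X != _](total_massE alpha) eqe gt_eqF.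
    by rewrite fin_num_measure.
  over.
rewrite /= -/(total_mass alpha) -/c.
rewrite ge0_integral_mnormalize/= ?stick_measureT//; last 3 first.
- by rewrite eqe invr_eq0 gt_eqF.
- exact: measurable_funeM.
- by move=> t; rewrite mule_ge0 ?integral_ge0// lee_fin invr_ge0 ltW.
rewrite invrK ge0_integralZl//; last 2 first.
- by move=> t _; rewrite integral_ge0.
- by rewrite lee_fin invr_ge0 ltW.
rewrite muleA -EFinM divff ?gt_eqF// mul1e ge0_integral_density//.
by move=> t; rewrite integral_ge0.
Qed.

End base_law.

(** * Uniqueness of the fixed point *)

Lemma bounded_Rintegrable d (T : measurableType d) (R : realType)
    (P : probability T R) (f : T -> R) :
  measurable_fun setT f -> (forall x, 0 <= f x <= 1) ->
  P.-integrable setT (EFin \o f).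
Proof.
move=> mf f01; apply: measurable_bounded_integrable => //.
  by rewrite -ge0_fin_numE// fin_num_measure.
exists 1; split => // M M1 x _ /=; have /andP[f0 f1] := f01 x.
by rewrite ger0_norm// (le_trans f1)// ltW.
Qed.

Section lipschitz_observables.
Context d (X : measurableType d) (R : realType).
Implicit Types (P Q : pprobability X R) (f g : pprobability X R -> R).

(** Lipschitz for total variation; quantifying over the bound [e] avoids a supremum over measurable
    sets. Values in [0, 1] keep products Lipschitz, which yields stability under intersection
    below. *)
Definition lip_observable (L : R) f := [/\ measurable_fun setT f,
  forall P, 0 <= f P <= 1, 0 <= L &
  forall P Q (e : R), (forall A, measurable A -> `|fine (P A) - fine (Q A)| <= e) ->
    `|f P - f Q| <= L * e].

Lemma lip_observableM L M f g : lip_observable L f -> lip_observable M g ->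
  lip_observable (L + M) (fun P => f P * g P).
Proof.
move=> [mf f01 L0 lf] [mg g01 M0 lg]; split.
- exact: measurable_funM.
- move=> P; have /andP[? ?] := f01 P; have /andP[? ?] := g01 P.
  by rewrite mulr_ge0//= mulr_ile1.
- exact: addr_ge0.
- move=> P Q e PQ.
  rewrite (_ : f P * g P - f Q * g Q = (f P - f Q) * g P + f Q * (g P - g Q)); last by ring.
  have /andP[gP0 gP1] := g01 P; have /andP[fQ0 fQ1] := f01 Q.
  rewrite (le_trans (ler_normD _ _))// [leRHS]mulrDl lerD// normrM.
    by rewrite (ger0_norm gP0) (le_trans (ler_piMr _ _))// lf.
  by rewrite (ger0_norm fQ0) (le_trans (ler_piMl _ _))// lg.
Qed.

Lemma clip_lipschitz (s t : R) : `|clip s - clip t| <= `|s - t|.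
Proof.
wlog st : s t / s <= t => [H|].
  have [/H//|/ltW/H] := leP s t; by rewrite distrC [leRHS]distrC.
rewrite (distrC s) (distrC (clip s)) (ger0_norm (x := t - s)) ?subr_ge0//.
rewrite /clip; case: (leP 1 s) => s1; case: (leP 1 t) => t1.
- by rewrite max_r// subrr normr0 subr_ge0.
- lra.
- rewrite max_r//; case: (leP 0 s) => s0; rewrite ger0_norm; lra.
- case: (leP 0 s) => s0; case: (leP 0 t) => t0; rewrite ger0_norm; lra.
Qed.

Lemma lip_observable_clip (A : set X) (r m : R) : measurable A -> 0 <= m ->
  lip_observable m (fun P => clip (m * (r - fine (P A)))).
Proof.
move=> mA m0; split => //.
- apply: (measurableT_comp (@measurable_clip R)); apply: measurable_funM => //.
  apply: measurable_funB => //; apply: measurableT_comp => //.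
  exact: measurable_pprobability_ev.
- by move=> P; rewrite clip_ge0 clip_le1.
- move=> P Q e PQ; rewrite (le_trans (clip_lipschitz _ _))//.
  rewrite (_ : _ - _ = m * (fine (Q A) - fine (P A))); last by ring.
  by rewrite normrM (ger0_norm m0) ler_wpM2l// distrC PQ.
Qed.

Definition approximable (U : set (pprobability X R)) := measurable U /\
  exists f : nat -> pprobability X R -> R,
    (forall n, exists L, lip_observable L (f n)) /\
    forall P, f n P @[n --> \oo] --> (\1_U P : R).

Lemma approximableI : setI_closed approximable.
Proof.
move=> U V [mU [f [Lf fU]]] [mV [g [Lg gV]]]; split; first exact: measurableI.
exists (fun n P => f n P * g n P); split.
  move=> n; have [L lf] := Lf n; have [M lg] := Lg n.
  by exists (L + M); exact: lip_observableM.
by move=> P; rewrite indicI; apply: cvgM.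
Qed.

Lemma approximableT : approximable setT.
Proof.
split => //; exists (fun _ _ => 1); split.
  move=> _; exists 0; split => //.
  - by move=> P; rewrite ler01 lexx.
  - by move=> P Q e _; rewrite subrr normr0 mul0r.
by move=> P; rewrite indicT; exact: cvg_cst.
Qed.

Lemma approximable_mset (A : set X) (r : R) : measurable A -> 0 <= r <= 1 ->
  approximable (mset A r).
Proof.
move=> mA /andP[r0 r1]; split.
  apply: sub_sigma_algebra; exists r; first by rewrite /= in_itv /= r0.
  by exists A.
(* A ramp of slope [n] in P A: where P A < r it eventually equals 1, and elsewhere it is 0 for every
   [n]. *)
exists (fun n P => clip (n%:R * (r - fine (P A)))); split.
  by move=> n; exists n%:R; exact: lip_observable_clip.
move=> P; have PA : P A = (fine (P A))%:E by rewrite fineK// fin_num_measure.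
rewrite indicE; have [Pr|Pr] := boolP (P \in mset A r).
  have {}Pr : 0 < r - fine (P A).
    by move: Pr; rewrite inE /mset /= PA lte_fin subr_gt0.
  apply: cvg_near_cst; exists (Num.truncn (r - fine (P A))^-1).+1 => // n /= nr.
  rewrite /clip min_l ?max_r//.
  by rewrite -ler_pdivrMr// mul1r; apply/ltW/(lt_le_trans (truncnS_gt _)); rewrite ler_nat.
have {}Pr : r - fine (P A) <= 0.
  by move: Pr; rewrite notin_setE /mset /= PA lte_fin => /negP; rewrite -leNgt subr_le0.
apply: cvg_near_cst; apply: nearW => n.
rewrite /clip max_l// ge_min; apply/orP; right.
by rewrite mulr_ge0_le0.
Qed.

Lemma pprobability_measurableE :
  @measurable _ (pprobability X R) = <<s approximable >>.
Proof.
apply/seteqP; split.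
  apply: smallest_sub; first exact: smallest_sigma_algebra.
  move=> _ [r /= r01 [A mA <-]]; apply: sub_sigma_algebra.
  by apply: approximable_mset => //; move: r01; rewrite in_itv.
apply: smallest_sub; first exact: sigma_algebra_measurable.
by move=> U [].
Qed.

(** Dominated convergence carries equality from observables to approximable sets, which generate the
    sigma-algebra and are stable under intersection. *)
Lemma eq_observables (Q Q' : pprobability (pprobability X R) R) :
  (forall L f, lip_observable L f -> (\int[Q]_P f P = \int[Q']_P f P)) ->
  forall U : set (pprobability X R), measurable U -> Q U = Q' U.
Proof.
move=> QQ'; apply: (@measure_unique _ _ _ approximable (fun=> setT)).
- exact: pprobability_measurableE.
- exact: approximableI.
- by move=> _; exact: approximableT.
- exact: bigcup_const.
- move=> U [mU [f [Lf fU]]].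
  have lim (Q0 : pprobability (pprobability X R) R) :
      (\int[Q0]_P (f n P)%:E)%E @[n --> \oo] --> Q0 U.
    have [] := @dominated_convergence _ _ _ Q0 setT measurableT
      (fun n P => (f n P)%:E) (fun P => (\1_U P)%:E) (cst 1%E).
    - by move=> n; have [L [mf _ _ _]] := Lf n; exact/measurable_EFinP.
    - exact/measurable_EFinP/measurable_indic.
    - by apply: aeW => P _; apply: cvg_EFin; [exact: nearW|exact: fU].
    - exact: finite_measure_integrable_cst.
    - apply: aeW => P n _ /=; have [L [_ f01 _ _]] := Lf n.
      by have /andP[f0 f1] := f01 P; rewrite lee_fin ger0_norm.
    - by move=> _ _; rewrite integral_indic// setIT.
  have QQ'n n : (\int[Q]_P (f n P)%:E = \int[Q']_P (f n P)%:E)%E.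
    have [L lf] := Lf n; have [mf f01 _ _] := lf.
    have iQ (Q0 : pprobability (pprobability X R) R) :
        (\int[Q0]_P (f n P)%:E = (\int[Q0]_P f n P)%:E)%E.
      rewrite /Rintegral fineK//; apply: integrable_fin_num => //.
      exact: bounded_Rintegrable.
    by rewrite !iQ (QQ' _ _ lf).
  have limQ : (\int[Q]_P (f n P)%:E)%E @[n --> \oo] --> Q' U.
    by under eq_fun do rewrite QQ'n; exact: lim.
  exact: cvg_unique (lim Q) limQ.
- by move=> _; rewrite [X in (X < _)%E](probability_setT Q) ltry.
Qed.

End lipschitz_observables.

Section fixpoint_uniqueness.
Context d (X : measurableType d) (R : realType).
Notation RX := (measurableTypeR R * X)%type.
Variable nu : probability RX R.
Implicit Type Q : pprobability (pprobability X R) R.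

Lemma stick_fixpoint_integral Q (f : pprobability X R -> \bar R) :
  stick_fixpoint nu Q -> measurable_fun setT f -> (forall P, 0 <= f P)%E ->
  (\int[Q]_P f P = \int[Q]_P \int[nu]_y f (pmix (y, P)))%E.
Proof.
move=> fpQ mf f0.
transitivity (\int[pushforward (nu \x Q) (@pmix _ X R)]_P f P)%E.
  apply: eq_measure_integral => U mU _; rewrite [LHS]fpQ//.
  rewrite /pushforward /product_measure1; apply: eq_integral => y _ /=.
  by congr (Q _); apply/seteqP; split => P; rewrite /xsection /= inE.
rewrite ge0_integral_pushforward// fubini_tonelli2//.
- by apply: measurableT_comp.
- by move=> z /=; exact: f0.
Qed.

(** The adjoint of T, acting on observables instead of laws. *)
Definition stick_step (f : pprobability X R -> R) (P : pprobability X R) : R :=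
  \int[nu]_y f (pmix (y, P)).

Definition stick_rate : R := \int[nu]_y (1 - clip y.1).

Lemma stick_rate_integrable :
  nu.-integrable setT (EFin \o (fun y : RX => 1 - clip y.1)).
Proof.
apply: bounded_Rintegrable.
  apply: measurable_funB => //; apply: (measurableT_comp (@measurable_clip R)).
  exact: measurable_fst.
by move=> y; rewrite onem_clip_ge0 gerBl clip_ge0.
Qed.

Lemma stick_step_integrable L f P : lip_observable L f ->
  nu.-integrable setT (EFin \o (fun y => f (pmix (y, P)))).
Proof.
move=> [mf f01 _ _]; apply: bounded_Rintegrable => //.
by apply: measurableT_comp => //; apply: measurableT_comp.
Qed.

Lemma stick_rate_ge0 : 0 <= stick_rate.
Proof. by apply: Rintegral_ge0 => y _; exact: onem_clip_ge0. Qed.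

Lemma stick_step_EFin L f P : lip_observable L f ->
  ((stick_step f P)%:E = \int[nu]_y (f (pmix (y, P)))%:E)%E.
Proof.
move=> lf; rewrite /stick_step /Rintegral fineK//.
by apply: integrable_fin_num => //; exact: stick_step_integrable lf.
Qed.

(** With the same stick, the Dirac parts of the two mixtures cancel and 1 - theta times the
    difference of [P] and [Q] remains; averaging over theta gives the rate. *)
Lemma lip_observable_step L f : lip_observable L f ->
  lip_observable (L * stick_rate) (stick_step f).
Proof.
move=> lf; have [mf f01 L0 fL] := lf.
have iT P := stick_step_integrable P lf.
split.
- have mg : measurable_fun setT (fun P => \int[nu]_y (f (pmix (y, P)))%:E)%E.
    apply: (@measurable_fun_fubini_tonelli_G _ _ _ _ _ nu
      (fun z : RX * pprobability X R => (f (pmix z))%:E)).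
      by apply/measurable_EFinP; apply: measurableT_comp.
    by move=> z; rewrite lee_fin; have /andP[] := f01 (pmix z).
  exact: measurableT_comp mg.
- move=> P; apply/andP; split.
    by apply: Rintegral_ge0 => y _; have /andP[] := f01 (pmix (y, P)).
  rewrite (@le_trans _ _ (\int[nu]_y (cst 1 y)))//.
    apply: le_Rintegral => //.
      exact: finite_measure_integrable_cst.
    by move=> y _; have /andP[] := f01 (pmix (y, P)).
  by rewrite Rintegral_cst// mul1r [X in fine X](probability_setT nu).
- by rewrite mulr_ge0// stick_rate_ge0.
- move=> P Q e PQ; rewrite /stick_step -RintegralB//.
  have iB : nu.-integrable setT
      (EFin \o (fun y => f (pmix (y, P)) - f (pmix (y, Q)))).
    exact: (integrableB measurableT (iT P) (iT Q)).
  rewrite (le_trans (le_normr_Rintegral measurableT iB))//.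
  rewrite mulrAC /stick_rate -RintegralZl//; last exact: stick_rate_integrable.
  apply: le_Rintegral => //.
  - exact: integrable_norm.
  - exact: integrableZl stick_rate_integrable.
  - move=> y _; rewrite -mulrA (mulrC e) fL// => A mA.
    rewrite [pmix (y, P) A]mixE [pmix (y, Q) A]mixE.
    rewrite diracE -(fineK (fin_num_measure P A mA)) -(fineK (fin_num_measure Q A mA)).
    rewrite -!EFinM -!EFinD /= (_ : _ - _ =
      (1 - clip y.1) * (fine (P A) - fine (Q A))); last by ring.
    by rewrite normrM (ger0_norm (onem_clip_ge0 _)) ler_wpM2l ?onem_clip_ge0// PQ.
Qed.

(** Each induction step moves one application of T from the laws to the observable, so the induction
    runs over all [L] and [f]. *)
Lemma stick_fixpoint_contraction Q Q' n : stick_fixpoint nu Q -> stick_fixpoint nu Q' ->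
  forall L f, lip_observable L f ->
  `|\int[Q]_P f P - \int[Q']_P f P| <= 2 * (L * stick_rate ^+ n).
Proof.
move=> fQ fQ'; elim: n => [|n IH] L f lf.
  have [mf f01 L0 fL] := lf; rewrite expr0 mulr1.
  have iQ (Q0 : pprobability (pprobability X R) R) :
      Q0.-integrable setT (EFin \o f) by exact: bounded_Rintegrable.
  (* Two probabilities differ by at most 1 on every set, so [f] stays within [L] of its value at
     [point]. Applied to both laws, this gives the constant 2. *)
  have Qpoint (Q0 : pprobability (pprobability X R) R) :
      `|\int[Q0]_P f P - f point| <= L.
    have icst r : Q0.-integrable setT (EFin \o cst r).
      exact: finite_measure_integrable_cst.
    have cstE r : \int[Q0]_P (cst r P) = r.
      by rewrite Rintegral_cst// [X in fine X](probability_setT Q0) mulr1.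
    rewrite -[X in _ - X]cstE.
    rewrite -(RintegralB measurableT (iQ Q0) (icst (f point))).
    have iB : Q0.-integrable setT (EFin \o (fun P => f P - cst (f point) P)).
      exact: (integrableB measurableT (iQ Q0) (icst (f point))).
    rewrite (le_trans (le_normr_Rintegral measurableT iB))// -[leRHS](cstE L).
    apply: le_Rintegral => //; first exact: integrable_norm.
    move=> P _ /=; rewrite (le_trans (fL P point 1 _)) ?mulr1// => A mA.
    have PA01 (P' : pprobability X R) : 0 <= fine (P' A) <= 1.
      rewrite fine_ge0//= -lee_fin fineK ?fin_num_measure//.
      exact: probability_le1.
    have := PA01 P; have := PA01 point; rewrite ler_norml; lra.
  have := Qpoint Q; have := Qpoint Q'; rewrite !ler_norml; lra.
have E Q0 : stick_fixpoint nu Q0 -> \int[Q0]_P f P = \int[Q0]_P stick_step f P.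
  move=> fQ0; have [mf f01 _ _] := lf; rewrite /Rintegral stick_fixpoint_integral//.
  - by congr fine; apply: eq_integral => P _; rewrite (stick_step_EFin _ lf).
  - exact/measurable_EFinP.
  - by move=> P; rewrite lee_fin; have /andP[] := f01 P.
rewrite !E// (le_trans (IH _ _ (lip_observable_step lf)))//.
by rewrite exprS !mulrA.
Qed.

Lemma stick_fixpoint_unique Q Q' : stick_rate < 1 ->
  stick_fixpoint nu Q -> stick_fixpoint nu Q' ->
  forall U : set (pprobability X R), measurable U -> Q U = Q' U.
Proof.
move=> r1 fQ fQ'; apply: eq_observables => L f lf.
have H n := stick_fixpoint_contraction n fQ fQ' lf.
apply/eqP; rewrite -subr_eq0 -normr_le0.
have : 2 * (L * stick_rate ^+ n) @[n --> \oo] --> 2 * (L * 0).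
  apply: cvgMl_tmp; apply: cvgMl_tmp; apply: cvg_expr.
  by rewrite ger0_norm// stick_rate_ge0.
rewrite !mulr0 => lim0; rewrite -(cvg_lim _ lim0)//.
by apply: limr_ge; [exact: cvgP lim0|exact: nearW].
Qed.

End fixpoint_uniqueness.

(** * The Dirichlet law and its naturality *)

Section dirichlet_fixpoint.
Context d (X : measurableType d) (R : realType).
Notation RX := (measurableTypeR R * X)%type.
Notation leb := (@lebesgue_measure R).
Implicit Types (alpha : Mstar X R) (Q : pprobability (pprobability X R) R).

Lemma stick_rate_base_law alpha :
  stick_rate (base_law alpha) = total_mass alpha / (total_mass alpha + 1).
Proof.
have c0 := total_mass_gt0 alpha; set c := total_mass alpha.
rewrite /stick_rate /Rintegral ge0_integral_base_law; last 2 first.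
- by have /integrableP[] := stick_rate_integrable (base_law alpha).
- by move=> y; rewrite lee_fin onem_clip_ge0.
(* The value is recognized as c times the integral of (1 - t)^c over ]0, 1[, the mean of 1 - theta
   under Beta(1, c). *)
rewrite (_ : c / (c + 1) = fine (c%:E * ((pospow (c + 1 + 1) 1 / (c + 1))%:E))%E); last first.
  by rewrite /pospow ler01 powR1 mul1r.
rewrite -integral_pospow_sub ?addr_gt0//.
congr fine; rewrite -ge0_integralZl//; last 3 first.
- apply/measurable_EFinP/measurable_funTS.
  by apply: (measurableT_comp (measurable_pospow _)); exact: measurable_funB.
- by move=> t _; rewrite lee_fin pospow_ge0.
- by rewrite lee_fin ltW.
rewrite [RHS]integral_mkcond; apply: eq_integral => t _ /=.
rewrite integral_cst// [X in (_ * (_ * X))%E]total_massE.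
rewrite -/c stick_densityE patchE indicE mem_setE in_itv /=.
have [/andP[t0 t1]|_] := boolP (0 < t < 1); last by rewrite mul0r mul0e.
rewrite mul1r clip_id ?ltW//= -!EFinM -pospow_mulr//; congr EFin; rewrite /=; ring.
Qed.

Lemma stick_rate_base_law_lt1 alpha : stick_rate (base_law alpha) < 1.
Proof.
have c0 := total_mass_gt0 alpha.
by rewrite stick_rate_base_law ltr_pdivrMr ?addr_gt0// mul1r ltrDl.
Qed.

Definition dirichlet_law alpha : pprobability (pprobability X R) R :=
  stick_law (base_law alpha).

Lemma measurable_dirichlet_law : measurable_fun [set: Mstar X R] dirichlet_law.
Proof. exact: (measurable_stick_law (@measurable_pbase_law _ X R)). Qed.

Lemma dirichlet_law_unique alpha Q : stick_fixpoint (base_law alpha) Q ->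
  forall U : set (pprobability X R), measurable U -> dirichlet_law alpha U = Q U.
Proof.
move=> fQ; apply: stick_fixpoint_unique fQ.
- exact: stick_rate_base_law_lt1.
- exact: stick_lawP.
Qed.

End dirichlet_fixpoint.

Section naturality.
Context d d' (X : measurableType d) (Y : measurableType d') (R : realType).
Variable kappa : {mfun X >-> Y}.

(** Push-forward commutes with mixing once the atom x is replaced by kappa x, and it preserves the
    total mass, so the stick density is the same on both sides. *)
Lemma stick_fixpoint_map (alpha : Mstar X R) (Q : pprobability (pprobability X R) R) :
  stick_fixpoint (base_law alpha) Q ->
  stick_fixpoint (base_law (M_map kappa alpha)) (P2_map kappa Q).
Proof.
move=> fQ U mU.
(* Writing the inner probability as that of a section of a measurable set gives its measurability in
   [y]. *)
pose V : set ((measurableTypeR R * Y) * pprobability X R) :=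
  [set z | U (pmix (z.1, P_map kappa z.2))].
have mV : measurable V.
  have mf : measurable_fun setT (fun z : (measurableTypeR R * Y) * pprobability X R =>
      pmix (z.1, P_map kappa z.2)).
    apply: measurableT_comp => //; apply: measurable_fun_pair.
      exact: measurable_fst.
    by apply: (measurableT_comp (measurable_P_map kappa)); exact: measurable_snd.
  by have := mf measurableT U mU; rewrite setTI.
pose G (y : measurableTypeR R * Y) : \bar R := Q (xsection V y).
have GE y : G y = Q [set P | U (pmix (y, P_map kappa P))].
  by congr (Q _); apply/seteqP; split => P; rewrite /xsection /= inE.
have mG : measurable_fun setT G by exact: measurable_fun_xsection.
have mU' : measurable (P_map (R := R) kappa @^-1` U).
  by have := measurable_P_map kappa measurableT mU; rewrite setTI.
rewrite [LHS](fQ _ mU').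
transitivity (\int[base_law alpha]_y G (y.1, kappa y.2))%E.
  apply: eq_integral => y _; rewrite GE; congr (Q _).
  have E P A : measurable A -> (P_map kappa (mix y P : pprobability X R) : pprobability Y R) A =
      (pmix ((y.1, kappa y.2), P_map kappa P)) A.
    by move=> mA; rewrite [RHS]mixE [LHS]mixE.
  apply/seteqP; split => P /=; apply: pprobability_saturated => // A mA.
    exact: E.
  exact/esym/E.
transitivity (\int[base_law (M_map kappa alpha)]_y G y)%E; last first.
  by apply: eq_integral => y _; rewrite GE.
rewrite !ge0_integral_base_law//; last first.
  apply: measurableT_comp => //; apply: measurable_fun_pair.
    exact: measurable_fst.
  by apply: measurableT_comp => //; exact: measurable_snd.
apply: eq_integral => t _; congr (_ * _)%E.
rewrite [RHS](_ : _ = \int[pushforward alpha kappa]_y G (t, y))%E//.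
rewrite ge0_integral_pushforward//.
exact: (measurableT_comp mG (pair1_measurable t)).
Qed.

Lemma dirichlet_law_natural (alpha : Mstar X R) (U : set (pprobability Y R)) :
  measurable U ->
  dirichlet_law (M_map kappa alpha) U = P2_map kappa (dirichlet_law alpha) U.
Proof.
by move=> mU; apply: dirichlet_law_unique => //; apply/stick_fixpoint_map/stick_lawP.
Qed.

End naturality.

(** * Lebesgue measure on tuples *)

Section tuple_lebesgue.
Context (R : realType).
Local Open Scope ereal_scope.
Notation leb := (@lebesgue_measure R).

(** A constant in front of [lebesgue_tuple], to carry the sigma-finite structure that Tonelli
    requires. *)
Definition leb_tuple n (A : set (n.-tuple R)) : \bar R := lebesgue_tuple R n A.

Section instance.
Variable n : nat.

Let leb_tuple0 : @leb_tuple n set0 = 0. Proof. exact: measure0. Qed.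

Let leb_tuple_ge0 A : 0 <= @leb_tuple n A. Proof. exact: measure_ge0. Qed.

Let leb_tuple_sigma_additive : semi_sigma_additive (@leb_tuple n).
Proof. exact: (@measure_semi_sigma_additive _ _ _ (lebesgue_tuple R n)). Qed.

HB.instance Definition _ := isMeasure.Build _ _ _ (@leb_tuple n)
  leb_tuple0 leb_tuple_ge0 leb_tuple_sigma_additive.

End instance.

Definition tuple_box n (k : nat) : set (n.-tuple R) :=
  [set t | forall i : 'I_n, `[(- k%:R)%R, k%:R%R]%classic (tnth t i)].

Lemma measurable_tuple_box n k : measurable (@tuple_box n k).
Proof.
rewrite (_ : @tuple_box n k = \bigcap_(i in [set: 'I_n])
    ((fun t : n.-tuple R => tnth t i) @^-1` `[(- k%:R)%R, k%:R%R]%classic)); last first.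
  by apply/seteqP; split => t tk i //; [move=> _|]; exact: tk.
apply: fin_bigcap_measurable => // i _.
rewrite -[X in measurable X]setTI.
by apply: measurable_tnth => //; exact: measurable_itv.
Qed.

Lemma leb_tuple_box n k : leb_tuple (@tuple_box n k) < +oo.
Proof.
elim: n => [|n IH].
  rewrite /leb_tuple /= (le_lt_trans (probability_le1 _ _))//; last exact: ltry.
  exact: measurable_tuple_box.
rewrite /leb_tuple /= /lebesgue_cons /pushforward.
rewrite (_ : _ @^-1` _ = @tuple_box n k `*` `[(- k%:R)%R, k%:R%R]%classic); last first.
  apply/seteqP; split => [[t u] /= H|[t u] [/= H1 H2] i].
    split => [i|]; last exact: (H ord0).
    by have := H (lift ord0 i); rewrite /= tnthS.
  by have [j ->|->] := unliftP ord0 i; rewrite ?tnthS//; exact: H1.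
rewrite product_measure1E//; last exact: measurable_tuple_box.
rewrite lte_mul_pinfty// ?ge0_fin_numE//.
have : leb `[(- k%:R)%R, k%:R%R] < +oo by rewrite lebesgue_measure_itv /=; case: ifP; rewrite ?ltry.
exact.
Qed.

Lemma leb_tuple_sigma_finite n : sigma_finite setT (@leb_tuple n).
Proof.
exists (@tuple_box n) => [|k]; last by split; [exact: measurable_tuple_box|exact: leb_tuple_box].
apply/esym/seteqP; split => // t _.
pose m := (\sum_(i < n) (Num.truncn `|tnth t i|).+1)%N.
exists m => // i; rewrite /= in_itv /= -ler_norml.
rewrite (le_trans (ltW (truncnS_gt _)))// ler_nat /m (bigD1 i)//=.
exact: leq_addr.
Qed.

HB.instance Definition _ n := Measure_isSigmaFinite.Build _ _ _ (@leb_tuple n)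
  (@leb_tuple_sigma_finite n).

Lemma integral_leb_tuple0 (f : 0.-tuple R -> \bar R) : measurable_fun setT f ->
  \int[@leb_tuple 0]_t f t = f [tuple].
Proof.
move=> mf; rewrite [LHS](_ : _ = \int[dirac [tuple]]_t f t)//.
by rewrite integral_dirac// diracT mul1e.
Qed.

Lemma integral_leb_tupleS n (f : n.+1.-tuple R -> \bar R) :
  measurable_fun setT f -> (forall t, 0 <= f t) ->
  \int[@leb_tuple n.+1]_t f t = \int[@leb_tuple n]_t \int[leb]_u f (tuple_cons (t, u)).
Proof.
move=> mf f0.
rewrite [LHS](_ : _ = \int[pushforward (@leb_tuple n \x leb) (@tuple_cons R n)]_t f t)//.
rewrite ge0_integral_pushforward// fubini_tonelli1//.
- exact: measurableT_comp.
- by move=> z; exact: f0.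
Qed.

(** Offsets are indexed by [nat], so that removing the first coordinate composes them with
    [succn]. *)
Definition tuple_affine n (r : R) (b : nat -> R) (t : n.-tuple R) : n.-tuple R :=
  [tuple (r * tnth t i + b i)%R | i < n].

Lemma measurable_tuple_affine n r b : measurable_fun setT (@tuple_affine n r b).
Proof.
apply/measurable_fun_tnthP => i.
rewrite (_ : _ \o _ = fun t : n.-tuple R => (r * tnth t i + b i)%R); last first.
  by apply/funext => t /=; rewrite tnth_mktuple.
by apply: measurable_funD => //; apply: measurable_funM => //; exact: measurable_tnth.
Qed.

Lemma tuple_affine_cons n r b (t : n.-tuple R) (u : R) :
  tuple_affine r b (tuple_cons (t, u)) =
  tuple_cons (tuple_affine r (b \o succn) t, r * u + b 0%N)%R.
Proof.
apply: eq_from_tnth => i; rewrite tnth_mktuple.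
have [j ->|->] := unliftP ord0 i; last by [].
by rewrite !tnthS tnth_mktuple /= /bump.
Qed.

Lemma ge0_integral_tuple_affine n (r : R) (b : nat -> R) (f : n.-tuple R -> \bar R) :
  (0 < r)%R -> measurable_fun setT f -> (forall t, 0 <= f t) ->
  \int[@leb_tuple n]_t f (tuple_affine r b t) = (r ^- n)%:E * \int[@leb_tuple n]_t f t.
Proof.
move=> r0; elim: n b f => [|n IH] b f mf f0.
  rewrite expr0 invr1 mul1e; apply: eq_integral => t _.
  by rewrite (tuple0 t) [tuple_affine _ _ _]tuple0.
rewrite !integral_leb_tupleS//; last first.
  by apply: measurableT_comp => //; exact: measurable_tuple_affine.
pose g t : \bar R := \int[leb]_u f (tuple_cons (t, u)).
have mfc : measurable_fun setT (f \o @tuple_cons R n) by exact: measurableT_comp.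
have mg : measurable_fun setT g.
  by apply: (@measurable_fun_fubini_tonelli_F _ _ _ _ _ leb _ mfc) => z; exact: f0.
have g0 t : 0 <= g t by apply: integral_ge0.
transitivity (\int[@leb_tuple n]_t ((r^-1)%:E * g (tuple_affine r (b \o succn) t))).
  apply: eq_integral => t _; under eq_integral do rewrite tuple_affine_cons.
  rewrite /g -(@ge0_integral_affine _ r (b 0%N))//.
  exact: (measurableT_comp mfc (pair1_measurable (tuple_affine r (b \o succn) t))).
rewrite ge0_integralZl//; last 2 first.
- by apply: measurableT_comp => //; exact: measurable_tuple_affine.
- by rewrite lee_fin invr_ge0 ltW.
by rewrite IH// muleA -EFinM -invfM -exprS.
Qed.

End tuple_lebesgue.

(** * The Dirichlet integral *)

Section simplex_coordinates.
Context (R : realType) (n : nat).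
Implicit Types (t : n.-tuple R) (s : R) (i : 'I_n.+1).

(* Barycentric coordinates of the simplex of points with nonnegative coordinates
   of sum s, in terms of the first n of them. *)
Definition scoord s t i : R := nth (s - \sum_(u <- t) u) t i.

Lemma scoord_widen s t (i : 'I_n) : scoord s t (widen_ord (leqnSn n) i) = tnth t i.
Proof. by rewrite /scoord (tnth_nth (s - \sum_(u <- t) u)). Qed.

Lemma scoord_max s t : scoord s t ord_max = s - \sum_(i < n) tnth t i.
Proof. by rewrite /scoord nth_default ?size_tuple//= big_tuple. Qed.

Lemma sum_scoord s t : \sum_i scoord s t i = s.
Proof.
rewrite big_ord_recr /= scoord_max; under eq_bigr do rewrite scoord_widen.
by rewrite addrC subrK.
Qed.

Lemma ord_widen_ind (I : 'I_n.+1 -> Prop) : (forall i : 'I_n, I (widen_ord (leqnSn n) i)) ->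
  I ord_max -> forall i, I i.
Proof.
move=> Iw Im i; have [ni|ni] := ltnP i n; last first.
  suff -> : i = ord_max by [].
  by apply/val_inj/eqP; rewrite eqn_leq ni andbT -ltnS ltn_ord.
by have -> : i = widen_ord (leqnSn n) (Ordinal ni) by exact/val_inj.
Qed.

Lemma measurable_scoord i :
  measurable_fun [set: R * n.-tuple R] (fun st : R * n.-tuple R => scoord st.1 st.2 i).
Proof.
elim/ord_widen_ind: i => [i|].
  under eq_fun do rewrite scoord_widen.
  by apply: (measurableT_comp (measurable_tnth i)); exact: measurable_snd.
under eq_fun do rewrite scoord_max.
apply: measurable_funB; first exact: measurable_fst.
apply: measurable_sum => i.
by apply: (measurableT_comp (measurable_tnth i)); exact: measurable_snd.
Qed.

Lemma measurable_scoord1 s i : measurable_fun [set: n.-tuple R] (scoord s ^~ i).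
Proof. exact: (measurableT_comp (measurable_scoord i) (pair1_measurable s)). Qed.

(* (1 - th) t + th e_j in chart coordinates, where the vertex e_n is the origin. *)
Definition toward_vertex (j : 'I_n.+1) (th : R) : n.-tuple R -> n.-tuple R :=
  tuple_affine (1 - th) (fun i : nat => if i == nat_of_ord j then th else 0).

Lemma scoord_toward_vertex j th t i :
  scoord 1 (toward_vertex j th t) i = (1 - th) * scoord 1 t i + (if i == j then th else 0).
Proof.
have tw (k : 'I_n) : tnth (toward_vertex j th t) k =
    (1 - th) * tnth t k + (if widen_ord (leqnSn n) k == j then th else 0).
  by rewrite tnth_mktuple.
elim/ord_widen_ind: i => [i|]; first by rewrite !scoord_widen.
(* The offsets of all barycentric coordinates sum to [th], so the last one is [th] minus those of
   the chart, whichever vertex [j] is. *)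
have sumj : \sum_(i < n.+1) (if i == j then th else 0) = th.
  by rewrite (bigD1 j)//= eqxx big1 ?addr0// => i /negbTE ->.
rewrite !scoord_max; under eq_bigr do rewrite tw.
move: sumj; rewrite big_ord_recr /= => sumj.
rewrite big_split /= -mulr_sumr; move: sumj.
set x := \sum_(i < n) (if _ then _ else _); set y := (if _ then _ else _).
move=> xy; have -> : y = th - x by rewrite -xy; ring.
ring.
Qed.

Lemma scoord_scale r t i : 0 < r ->
  scoord r (tuple_affine r (fun=> 0) t) i = r * scoord 1 t i.
Proof.
have tw (k : 'I_n) : tnth (tuple_affine r (fun=> 0) t) k = r * tnth t k.
  by rewrite tnth_mktuple addr0.
move=> r0; elim/ord_widen_ind: i => [i|]; first by rewrite !scoord_widen.
rewrite !scoord_max; under eq_bigr do rewrite tw.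
by rewrite -mulr_sumr; ring.
Qed.

Variable a : 'I_n.+1 -> R.

(** The Dirichlet density without its constant, on the simplex of total [s]. A negative coordinate
    makes it vanish, so integrals can run over all tuples; a variable [s] allows integration over
    the total. *)
Definition simplex_weight s t : R := \prod_i pospow (a i) (scoord s t i).

Lemma simplex_weight_ge0 s t : 0 <= simplex_weight s t.
Proof. by apply: prodr_ge0 => i _; exact: pospow_ge0. Qed.

Lemma measurable_simplex_weight :
  measurable_fun [set: R * n.-tuple R] (fun st : R * n.-tuple R => simplex_weight st.1 st.2).
Proof.
apply: measurable_prod => i _; apply: (measurableT_comp (measurable_pospow _)).
exact: measurable_scoord.
Qed.

Lemma measurable_simplex_weight1 s : measurable_fun [set: n.-tuple R] (simplex_weight s).
Proof. exact: (measurableT_comp measurable_simplex_weight (pair1_measurable s)). Qed.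

Local Open Scope ereal_scope.

Definition simplex_mass (s : R) : \bar R :=
  \int[@leb_tuple R n]_t (simplex_weight s t)%:E.

(** The Jacobian contributes s^n and the weight is homogeneous of degree sum a_i - (n + 1). *)
Lemma simplex_mass_scale (s : R) : (0 < s)%R ->
  simplex_mass s = (s `^ (\sum_i a i - 1))%:E * simplex_mass 1.
Proof.
move=> s0.
have mE r : measurable_fun setT (fun t => (simplex_weight r t)%:E).
  by apply/measurable_EFinP; exact: measurable_simplex_weight1.
have E0 r (t : n.-tuple R) : 0 <= (simplex_weight r t)%:E.
  by rewrite lee_fin simplex_weight_ge0.
have := ge0_integral_tuple_affine (fun=> 0%R) s0 (mE s) (E0 s).
have wE t : simplex_weight s (tuple_affine s (fun=> 0%R) t) =
    (s `^ (\sum_i (a i - 1)) * simplex_weight 1 t)%R.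
  rewrite /simplex_weight; under eq_bigr do rewrite scoord_scale// pospowM//.
  rewrite big_split /=; congr (_ * _)%R.
  by rewrite /powR gt_eqF// mulr_suml expR_sum.
under eq_integral do rewrite wE EFinM.
rewrite ge0_integralZl//; last by rewrite lee_fin powR_ge0.
rewrite -/(simplex_mass 1) -/(simplex_mass s) => H.
have : (s ^+ n)%:E * ((s `^ (\sum_i (a i - 1)))%:E * simplex_mass 1) =
    (s ^+ n)%:E * ((s ^- n)%:E * simplex_mass s) by rewrite H.
rewrite !muleA -!EFinM divff ?expf_neq0 ?gt_eqF// mul1e => <-.
congr (_%:E * _); rewrite -powR_mulrn ?ltW// -powRD; last by rewrite (gt_eqF s0) implybT.
congr (_ `^ _)%R; rewrite big_split /= sumr_const card_ord.
by rewrite mulNrn mulrSr; ring.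
Qed.

End simplex_coordinates.

Section simplex_mass_Gamma.
Context (R : realType).
Local Open Scope ereal_scope.
Notation leb := (@lebesgue_measure R).

Lemma integral_leb_tuple_prod n (g : nat -> R -> R) :
  (forall i, measurable_fun setT (g i)) -> (forall i x, (0 <= g i x)%R) ->
  \int[@leb_tuple R n]_t (\prod_(i < n) g i (tnth t i))%:E =
  \prod_(i < n) \int[leb]_x (g i x)%:E.
Proof.
elim: n g => [|n IH] g mg g0.
  rewrite integral_leb_tuple0; first by rewrite !big_ord0.
  by under eq_fun do rewrite big_ord0; exact: measurable_cst.
have mp m (h : nat -> R -> R) : (forall i, measurable_fun setT (h i)) ->
    measurable_fun setT (fun t : m.-tuple R => (\prod_(i < m) h i (tnth t i))%:E).
  move=> mh; apply/measurable_EFinP; apply: measurable_prod => i _.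
  by apply: measurableT_comp => //; exact: measurable_tnth.
rewrite integral_leb_tupleS//; [|exact: mp|]; last first.
  by move=> t; rewrite lee_fin prodr_ge0.
have gu0 : 0 <= \int[leb]_u (g 0%N u)%:E by apply: integral_ge0 => u _; rewrite lee_fin.
transitivity (\int[@leb_tuple R n]_t ((\int[leb]_u (g 0%N u)%:E) *
    (\prod_(i < n) g i.+1 (tnth t i))%:E)).
  apply: eq_integral => t _.
  transitivity (\int[leb]_u ((\prod_(i < n) g i.+1 (tnth t i))%:E * (g 0%N u)%:E)).
    apply: eq_integral => u _; rewrite big_ord_recl /= EFinM muleC.
    by congr ((_)%:E * _); apply: eq_bigr => i _; rewrite tnthS.
  rewrite ge0_integralZl//; last 3 first.
  - by apply/measurable_EFinP; exact: (mg 0%N).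
  - by move=> u _; rewrite lee_fin.
  - by rewrite lee_fin prodr_ge0.
  by rewrite muleC.
rewrite ge0_integralZl//; last 2 first.
- by apply: (mp n (fun i => g i.+1)) => i; exact: mg.
- by move=> t _; rewrite lee_fin prodr_ge0.
by rewrite (IH (fun i => g i.+1))// big_ord_recl.
Qed.

Lemma simplex_mass_neg n (a : 'I_n.+1 -> R) (s : R) : (s < 0)%R -> simplex_mass a s = 0.
Proof.
move=> s0; apply: integral0_eq => t _; congr EFin.
apply/eqP/prodf_eq0.
have [i ti] : exists i, (scoord s t i < 0)%R.
  apply/not_existsP => H; have : (0 <= s)%R.
    rewrite -(sum_scoord s t) sumr_ge0// => i _.
    by rewrite leNgt; apply/negP; exact: H.
  by rewrite leNgt s0.
by exists i => //; rewrite /pospow leNgt ti.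
Qed.

(** Tonelli puts the integral over the total [s] inside. A shift by the sum of [t] then makes the
    last barycentric coordinate the variable, and exp(-s) splits into one factor per coordinate. *)
Lemma integral_simplex_mass n (a : 'I_n.+1 -> R) :
  \int[leb]_s ((expR (- s))%:E * simplex_mass a s) = \prod_i eGamma (a i).
Proof.
pose F (z : n.-tuple R * measurableTypeR R) : \bar R :=
  (expR (- z.2) * simplex_weight a z.2 z.1)%:E.
have F0 z : 0 <= F z by rewrite lee_fin mulr_ge0 ?expR_ge0 ?simplex_weight_ge0.
have mF : measurable_fun setT F.
  apply/measurable_EFinP; apply: measurable_funM.
    apply: (measurableT_comp (@measurable_expR R)); apply: measurable_funN.
    exact: measurable_snd.
  have msw : measurable_fun setT (fun z : n.-tuple R * measurableTypeR R => (z.2, z.1)).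
    by apply: measurable_fun_pair; [exact: measurable_snd|exact: measurable_fst].
  exact: (measurableT_comp (measurable_simplex_weight a) msw).
transitivity (\int[leb]_s \int[@leb_tuple R n]_t F (t, s)).
  apply: eq_integral => s _; rewrite /F /simplex_mass -ge0_integralZl//; last 2 first.
  - by apply/measurable_EFinP; exact: measurable_simplex_weight1.
  - by move=> t _; rewrite lee_fin simplex_weight_ge0.
rewrite -[LHS](@fubini_tonelli _ _ _ _ _ (@leb_tuple R n) leb F mF F0).
pose g (i : nat) (x : R) : R := (pospow (a (inord i)) x * expR (- x))%R.
have g0 i x : (0 <= g i x)%R by rewrite mulr_ge0 ?pospow_ge0 ?expR_ge0.
have mg i : measurable_fun setT (g i).
  apply: measurable_funM; first exact: measurable_pospow.
  by apply: (measurableT_comp (@measurable_expR R)).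
transitivity (\int[@leb_tuple R n]_t ((\int[leb]_x (g n x)%:E) *
    (\prod_(i < n) g i (tnth t i))%:E)).
  apply: eq_integral => t _; rewrite /fubini_F.
  pose S := (\sum_(i < n) tnth t i)%R.
  rewrite -(@ge0_integral_shift _ S (fun x => (g n x)%:E)); last 2 first.
  - exact/measurable_EFinP.
  - by move=> x; rewrite lee_fin.
  rewrite muleC -ge0_integralZl//; last 3 first.
  - apply/measurable_EFinP; apply: measurableT_comp => //.
    exact: measurable_funB.
  - by move=> x _; rewrite lee_fin.
  - by rewrite lee_fin prodr_ge0.
  apply: eq_integral => s _; rewrite /F -EFinM; congr EFin.
  rewrite /simplex_weight big_ord_recr /= scoord_max -/S.
  under eq_bigr do rewrite scoord_widen.
  rewrite /g (_ : inord n = ord_max); last by apply/val_inj; rewrite /= inordK.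
  rewrite (_ : expR (- s) = expR (- (s - S)) * \prod_(i < n) expR (- tnth t i))%R; last first.
    by rewrite -expR_sum -expRD sumrN -/S; congr expR; ring.
  rewrite [in RHS]big_split /= [RHS](_ : _ = (expR (- (s - S)) *
    \prod_(i < n) expR (- tnth t i)) * (\prod_(i < n) pospow (a (inord i)) (tnth t i) *
      pospow (a ord_max) (s - S)))%R; last by ring.
  congr (_ * (_ * _))%R; apply: eq_bigr => i _; congr (pospow (a _) _).
  by apply/val_inj; rewrite /= inordK// ltnW// ltnS.
rewrite ge0_integralZl//; last 3 first.
- apply/measurable_EFinP; apply: measurable_prod => i _.
  by apply: measurableT_comp => //; exact: measurable_tnth.
- by move=> t _; rewrite lee_fin prodr_ge0.
- by apply: integral_ge0 => x _; rewrite lee_fin.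
rewrite integral_leb_tuple_prod// muleC big_ord_recr /=; congr (_ * _).
  apply: eq_bigr => i _; rewrite /g /eGamma (_ : inord i = widen_ord (leqnSn n) i)//.
  by apply/val_inj; rewrite /= inordK// ltnW// ltnS.
by rewrite /g (_ : inord n = ord_max)//; apply/val_inj; rewrite /= inordK.
Qed.

Lemma simplex_mass1 n (a : 'I_n.+1 -> R) : (forall i, (0 < a i)%R) ->
  simplex_mass a 1 = ((\prod_i Gamma (a i)) / Gamma (\sum_i a i))%:E.
Proof.
move=> a0; have c0 : (0 < \sum_i a i)%R.
  by rewrite big_ord_recr /= ltr_wpDl// sumr_ge0// => i _; exact: ltW.
have mM : measurable_fun setT (fun s : R => simplex_mass a s).
  pose F (z : n.-tuple R * measurableTypeR R) : \bar R := (simplex_weight a z.2 z.1)%:E.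
  apply: (@measurable_fun_fubini_tonelli_G _ _ _ _ _ (@leb_tuple R n) F).
    apply/measurable_EFinP.
    have msw : measurable_fun setT (fun z : n.-tuple R * measurableTypeR R => (z.2, z.1)).
      by apply: measurable_fun_pair; [exact: measurable_snd|exact: measurable_fst].
    exact: (measurableT_comp (measurable_simplex_weight a) msw).
  by move=> z; rewrite lee_fin simplex_weight_ge0.
have M0 s : 0 <= simplex_mass a s.
  by apply: integral_ge0 => t _; rewrite lee_fin simplex_weight_ge0.
have mf : measurable_fun setT (fun s : R => (expR (- s))%:E * simplex_mass a s).
  apply: emeasurable_funM => //; apply/measurable_EFinP.
  by apply: (measurableT_comp (@measurable_expR R)).
have H := integral_simplex_mass a.
(* By scaling, the mass at total s is s^(c - 1) times the mass at 1, where c is the sum of the a_i;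
   integrating against exp(-s) produces Gamma(c). *)
have : eGamma (\sum_i a i) * simplex_mass a 1 = \prod_i eGamma (a i).
  rewrite -H muleC eGammaE -ge0_integralZl//; last 2 first.
  - apply/measurable_EFinP/measurable_funTS/measurable_funM; first exact: measurable_powR.
    by apply: (measurableT_comp (@measurable_expR R)).
  - by move=> x _; rewrite lee_fin mulr_ge0 ?powR_ge0 ?expR_ge0.
  transitivity (\int[leb]_(s in `]0%R, +oo[) ((expR (- s))%:E * simplex_mass a s)).
    apply: eq_integral => s; rewrite inE /= in_itv /= andbT => s0.
    by rewrite (simplex_mass_scale a s0) EFinM muleC -muleA muleCA.
  rewrite integral_itv_obnd_cbnd; last exact: measurable_funTS.
  rewrite integral_mkcond; apply: eq_integral => s _.
  rewrite patchE mem_setE in_itv /= andbT; case: ifPn => //.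
  by rewrite -ltNge => s0; rewrite simplex_mass_neg// mule0.
rewrite eGammaEFin//; under [X in _ = X]eq_bigr do rewrite eGammaEFin//.
rewrite prodEFin mulrC EFinM => <-.
by rewrite muleA -EFinM mulVf ?mul1e// gt_eqF// Gamma_gt0.
Qed.

End simplex_mass_Gamma.

(** * The simplex of probability measures on a finite space *)

Section finite_space.
Context (R : realType) (n : nat).
Local Open Scope ereal_scope.
Implicit Type mu : {measure set 'I_n.+1 -> \bar R}.

Lemma measure_ordE mu (A : set 'I_n.+1) :
  mu A = \sum_(i < n.+1) mu [set i] * \d_i A.
Proof.
transitivity (\sum_(i < n.+1 | i \in A) mu [set i]).
  rewrite -measure_bigsetU_ord//; last by move=> i j _ _ [x [->]].
  rewrite -(bigcup_pred (mem A)); congr (mu _); apply/seteqP; split => [x Ax|x].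
    by exists x => //=; apply/mem_set.
  by move=> [i /= iA ->]; apply/set_mem.
rewrite big_mkcond; apply: eq_bigr => i _; rewrite diracE.
by case: ifP => _; rewrite ?mule1 ?mule0.
Qed.

Lemma ge0_integral_ord mu (f : 'I_n.+1 -> \bar R) : (forall i, 0 <= f i) ->
  \int[mu]_i f i = \sum_(i < n.+1) mu [set i] * f i.
Proof.
move=> f0.
transitivity (\int[mu]_x \sum_(i < n.+1) (f i * (\1_[set i] x)%:E)).
  apply: eq_integral => x _; rewrite (bigD1 x)//= big1 ?adde0.
    by rewrite indicE mem_set// mule1.
  by move=> i ix; rewrite indicE memNset ?mule0//= => xi; rewrite xi eqxx in ix.
rewrite ge0_integral_sum//; last by move=> i x _; rewrite mule_ge0.
apply: eq_bigr => i _; rewrite ge0_integralZl// integral_indic// setIT.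
by rewrite muleC.
Qed.

End finite_space.

Section simplex_points.
Context (R : realType) (n : nat).
Local Open Scope ereal_scope.
Implicit Type t : n.-tuple R.

Definition simplex : set (n.-tuple R) := [set t | forall i, (0 <= scoord 1 t i)%R].

(** Absolute values give a measure for every tuple, hence a kernel that can be normalized; on the
    simplex they change nothing. *)
Let coord_mass t (i : nat) : {measure set 'I_n.+1 -> \bar R} :=
  mscale (NngNum (normr_ge0 (scoord 1 t (inord i)))) (dirac (inord i : 'I_n.+1)).

Let coord_measure t : {measure set 'I_n.+1 -> \bar R} := msum (coord_mass t) n.+1.

Let coord_measureE t A :
  coord_measure t A = \sum_(i < n.+1) (`|scoord 1 t i|)%:E * \d_i A.
Proof.
by apply: eq_bigr => i _; rewrite /coord_mass /mscale /= inord_val.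
Qed.

Let measurable_coord_measure A : measurable A ->
  measurable_fun setT (coord_measure ^~ A).
Proof.
move=> mA; under eq_fun do rewrite coord_measureE.
apply: emeasurable_sum => i; apply: emeasurable_funM => //.
apply/measurable_EFinP; apply: measurableT_comp => //.
exact: measurable_scoord1.
Qed.

HB.instance Definition _ := isKernel.Build _ _ _ _ _ coord_measure
  measurable_coord_measure.

(* Outside the simplex this is a junk value. *)
Definition simplex_point t : pprobability 'I_n.+1 R :=
  mnormalize (coord_measure t) point.

Lemma measurable_simplex_point : measurable_fun setT simplex_point.
Proof. exact: (measurable_fun_mnormalize coord_measure). Qed.

HB.instance Definition _ := isMeasurableFun.Build _ _ _ _ simplex_point
  measurable_simplex_point.

Lemma simplex_pointE t A : simplex t ->
  simplex_point t A = \sum_(i < n.+1) (scoord 1 t i)%:E * \d_i A.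
Proof.
move=> t0.
have mE B : coord_measure t B = \sum_(i < n.+1) (scoord 1 t i)%:E * \d_i B.
  rewrite coord_measureE; apply: eq_bigr => i _.
  by rewrite ger0_norm//; exact: t0.
have m1 : coord_measure t setT = 1.
  rewrite mE; under eq_bigr do rewrite diracT mule1.
  by rewrite sumEFin sum_scoord.
rewrite -mE -[LHS]/(mnormalize (coord_measure t) point A) /mnormalize m1 /=.
by rewrite onee_eq0 /= invr1 mule1.
Qed.

Lemma simplex_point1 t i : simplex t -> simplex_point t [set i] = (scoord 1 t i)%:E.
Proof.
move=> t0; rewrite simplex_pointE// (bigD1 i)//= big1 ?adde0.
  by rewrite diracE mem_set// mule1.
by move=> j ji; rewrite diracE memNset ?mule0//= => E; rewrite E eqxx in ji.
Qed.

Lemma scoord_simplex_chart (P : pprobability 'I_n.+1 R) i :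
  scoord 1 (simplex_chart P) i = fine (P [set i]).
Proof.
elim/ord_widen_ind: i => [i|]; first by rewrite scoord_widen tnth_mktuple.
rewrite scoord_max; under eq_bigr do rewrite tnth_mktuple.
have : 1 = \sum_(i < n.+1) (fine (P [set i]))%:E.
  rewrite -[LHS](probability_setT P) [LHS]measure_ordE; apply: eq_bigr => i _.
  by rewrite diracT mule1 fineK// fin_num_measure.
by rewrite sumEFin => -[->]; rewrite big_ord_recr /= addrAC subrr add0r.
Qed.

(** Turns the forward image in the definition of [dirichlet_pos] into a preimage. The chart and
    [simplex_point] are inverse only up to agreement on measurable sets, so the saturation of [A]
    enters. *)
Lemma simplex_chart_image (A : set (pprobability 'I_n.+1 R)) : measurable A ->
  @simplex_chart R n @` A = simplex `&` simplex_point @^-1` A.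
Proof.
move=> mA; apply/seteqP; split => [_ [P AP <-]|t [t0 At]]; last first.
  exists (simplex_point t) => //; apply: eq_from_tnth => i.
  by rewrite tnth_mktuple simplex_point1//= scoord_widen.
have S0 : simplex (simplex_chart P).
  by move=> i; rewrite scoord_simplex_chart fine_ge0.
split => //; apply: pprobability_saturated AP => // B mB.
rewrite simplex_pointE// [LHS]measure_ordE; apply: eq_bigr => i _.
by rewrite scoord_simplex_chart fineK// fin_num_measure.
Qed.

End simplex_points.

(** * The classical Dirichlet distribution is a fixed point *)

Section positive_dirichlet.
Context (R : realType) (n : nat) (a : 'I_n.+1 -> R).
Hypothesis a0 : forall i, 0 < a i.
Local Open Scope ereal_scope.
Implicit Type t : n.-tuple R.
Notation leb := (@lebesgue_measure R).
Notation lebn := (@leb_tuple R n).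

Definition dirichlet_cst : R := (Gamma (\sum_i a i) / \prod_i Gamma (a i))%R.

Lemma sum_param_gt0 : (0 < \sum_i a i)%R.
Proof. by rewrite big_ord_recr /= ltr_wpDl// sumr_ge0// => i _; exact: ltW. Qed.

Lemma dirichlet_cst_gt0 : (0 < dirichlet_cst)%R.
Proof.
rewrite divr_gt0// ?Gamma_gt0 ?sum_param_gt0//.
by apply: prodr_gt0 => i _; exact: Gamma_gt0.
Qed.

Definition dirichlet_weight t : R := (dirichlet_cst * simplex_weight a 1 t)%R.

Lemma dirichlet_weight_ge0 t : (0 <= dirichlet_weight t)%R.
Proof. by rewrite mulr_ge0 ?simplex_weight_ge0// ltW// dirichlet_cst_gt0. Qed.

Lemma measurable_dirichlet_weight : measurable_fun setT dirichlet_weight.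
Proof. by apply: measurable_funM => //; exact: measurable_simplex_weight1. Qed.

Definition dirichlet_measure : {measure set (n.-tuple R) -> \bar R} :=
  density_measure lebn measurable_dirichlet_weight dirichlet_weight_ge0.

Lemma dirichlet_measureT : dirichlet_measure setT = 1.
Proof.
rewrite /dirichlet_measure /= /density_measure /dirichlet_weight.
under eq_integral do rewrite EFinM.
rewrite ge0_integralZl//; last 3 first.
- by apply/measurable_EFinP; exact: measurable_simplex_weight1.
- by move=> t _; rewrite lee_fin simplex_weight_ge0.
- by rewrite lee_fin ltW// dirichlet_cst_gt0.
rewrite -/(simplex_mass a 1) simplex_mass1// -EFinM /dirichlet_cst.
rewrite mulrA divfK ?divff//.
  by rewrite gt_eqF// Gamma_gt0// sum_param_gt0.
by rewrite gt_eqF// prodr_gt0// => i _; exact: Gamma_gt0.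
Qed.

(** The mass is 1 already by [dirichlet_measureT]; [mnormalize] packages the measure as a
    probability. *)
Definition dirichlet_pos_law : pprobability (pprobability 'I_n.+1 R) R :=
  distribution (mnormalize dirichlet_measure point) (@simplex_point R n).

Lemma dirichlet_pos_lawE (U : set (pprobability 'I_n.+1 R)) :
  measurable U ->
  dirichlet_pos_law U =
  \int[lebn]_t (dirichlet_weight t * \1_U (simplex_point t))%:E.
Proof.
move=> mU.
rewrite [LHS](_ : _ = mnormalize dirichlet_measure point (@simplex_point R n @^-1` U))//.
rewrite /mnormalize dirichlet_measureT onee_eq0 /= invr1 mule1 /density_measure.
rewrite integral_mkcond; apply: eq_integral => t _.
rewrite patchE indicE; have [tU|tU] := boolP (simplex_point t \in U).
  by rewrite mem_set ?mulr1//=; exact: set_mem tU.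
by rewrite memNset ?mulr0//= => /mem_set; exact/negP.
Qed.

Lemma dirichlet_posE (U : set (pprobability 'I_n.+1 R)) :
  measurable U -> dirichlet_pos a U = dirichlet_pos_law U.
Proof.
move=> mU; rewrite dirichlet_pos_lawE// /dirichlet_pos simplex_chart_image//.
rewrite integral_mkcond; apply: eq_integral => t _; rewrite patchE.
have [tS|tS] := pselect (simplex t); last first.
  rewrite memNset; last by move=> -[].
  rewrite /dirichlet_weight (_ : simplex_weight a 1 t = 0%R) ?mulr0 ?mul0r//.
  move: tS => /existsNP[i /negP ti].
  by apply/eqP/prodf_eq0; exists i => //; rewrite /pospow (negbTE ti).
have pdfE : dirichlet_pdf a t = dirichlet_weight t.
  rewrite /dirichlet_pdf /dirichlet_weight; congr (_ * _)%R.
  by apply: eq_bigr => i _; rewrite /pospow tS.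
rewrite indicE; have [tU|tU] := boolP (simplex_point t \in U).
  by rewrite mem_set ?pdfE ?mulr1//; split => //; exact: set_mem tU.
by rewrite memNset ?mulr0// => -[_ /mem_set]; exact/negP.
Qed.

Lemma dirichlet_pos_law_step (j : 'I_n.+1) (g : n.-tuple R -> R) :
  measurable_fun setT g -> (forall t, (0 <= g t)%R) ->
  \int[leb]_th ((stick_density (\sum_i a i) th)%:E *
    \int[lebn]_t (simplex_weight a 1 t * g (toward_vertex j th t))%:E) =
  \int[lebn]_t (simplex_weight a 1 t * (scoord 1 t j / a j) * g t)%:E.
Proof.
move=> mg g0; set c := (\sum_i a i)%R.
pose I := (`]0%R, 1%R[%classic : set R).
have mI : measurable I by exact: measurable_itv.
(* The weight of the point before mixing, expressed at the point after mixing and stripped of its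
   power of 1 - theta. *)
pose w (th : R) t : R := (\prod_i pospow (a i) (scoord 1 t i - (if i == j then th else 0)))%R.
pose F (z : measurableTypeR R * n.-tuple R) : \bar R :=
  (\1_I z.1 * (w z.1 z.2 * g z.2))%:E.
have w0 th t : (0 <= w th t)%R by apply: prodr_ge0 => i _; exact: pospow_ge0.
have F0 z : 0 <= F z by rewrite lee_fin !mulr_ge0.
have mw : measurable_fun setT (fun z : measurableTypeR R * n.-tuple R => w z.1 z.2).
  apply: measurable_prod => i _; apply: (measurableT_comp (measurable_pospow _)).
  apply: measurable_funB.
    by apply: (measurableT_comp (measurable_scoord1 1 i)); exact: measurable_snd.
  by case: (i == j); [exact: measurable_fst|exact: measurable_cst].
have mF : measurable_fun setT F.
  apply/measurable_EFinP; apply: measurable_funM.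
    have m1I : measurable_fun setT (\1_I : measurableTypeR R -> R).
      exact: measurable_indic.
    by apply: (measurableT_comp m1I); exact: measurable_fst.
  apply: measurable_funM => //.
  by apply: (measurableT_comp mg); exact: measurable_snd.
transitivity (\int[leb]_th \int[lebn]_t F (th, t)).
  apply: eq_integral => th _; rewrite stick_densityE.
  rewrite /F /=; have [thI|thI] := boolP (th \in I); last first.
    rewrite !indicE (negbTE thI) mul0r mul0e integral0_eq// => t _.
    by rewrite mul0r.
  move: (thI); rewrite inE /I /= in_itv /= => /andP[th0 th1].
  have r0 : (0 < 1 - th)%R by rewrite subr_gt0.
  have wE t : w th (toward_vertex j th t) =
      ((1 - th) `^ (c - n.+1%:R) * simplex_weight a 1 t)%R.
    rewrite /w /simplex_weight.
    under eq_bigr do rewrite scoord_toward_vertex addrK pospowM//.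
    rewrite big_split /=; congr (_ * _)%R.
    rewrite /powR gt_eqF// -expR_sum -mulr_suml sumrB sumr_const card_ord.
    by [].
  pose f t : \bar R := (w th t * g t)%:E.
  have mf : measurable_fun setT f.
    apply/measurable_EFinP/measurable_funM => //.
    exact: (measurableT_comp mw (pair1_measurable th)).
  have f0 t : 0 <= f t by rewrite lee_fin mulr_ge0.
  have := ge0_integral_tuple_affine (fun i : nat => if i == nat_of_ord j then th else 0%R) r0 mf f0.
  rewrite -/(toward_vertex j th) => H.
  pose A := \int[lebn]_t (simplex_weight a 1 t * g (toward_vertex j th t))%:E.
  have intf : \int[lebn]_t f (toward_vertex j th t) = ((1 - th) `^ (c - n.+1%:R))%:E * A.
    rewrite -ge0_integralZl//.
    - by apply: eq_integral => t _; rewrite /f wE -EFinM mulrA.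
    - apply/measurable_EFinP/measurable_funM; first exact: measurable_simplex_weight1.
      by apply: measurableT_comp => //; exact: measurable_tuple_affine.
    - by move=> t _; rewrite lee_fin mulr_ge0// simplex_weight_ge0.
    - by rewrite lee_fin powR_ge0.
  rewrite -/A indicE thI mul1r /=.
  under [RHS]eq_integral do rewrite mul1r.
  rewrite -/(f _) -[RHS]mul1e.
  (* The factor (1 - theta)^(c - 1) of the stick density splits into (1 - theta)^n, which cancels
     the Jacobian, and (1 - theta)^(c - n - 1), the homogeneity factor of the weight. *)
  have -> : 1 = ((1 - th) ^+ n)%:E * ((1 - th) ^- n)%:E.
    by rewrite -EFinM divff// expf_neq0// gt_eqF.
  rewrite -muleA -H intf muleA -EFinM; congr (_%:E * _).
  rewrite /pospow ltW// -powR_mulrn ?ltW// -powRD; last by rewrite (gt_eqF r0) implybT.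
  by congr (_ `^ _)%R; rewrite -natr1; ring.
rewrite [LHS](@fubini_tonelli _ _ _ _ _ leb lebn F mF F0).
apply: eq_integral => t _.
pose V := (\prod_(i < n.+1 | i != j) pospow (a i) (scoord 1 t i))%R.
have V0 : (0 <= V)%R by apply: prodr_ge0 => i _; exact: pospow_ge0.
have WE : simplex_weight a 1 t = (pospow (a j) (scoord 1 t j) * V)%R.
  by rewrite /simplex_weight (bigD1 j).
have wE th : w th t = (pospow (a j) (scoord 1 t j - th) * V)%R.
  rewrite /w (bigD1 j)//= eqxx; congr (_ * _)%R.
  by apply: eq_bigr => i /negbTE ->; rewrite subr0.
(* If the factors other than the [j]-th are nonzero, their coordinates are nonnegative, so the
   [j]-th is at most 1, as the integral over theta requires. Otherwise both sides vanish. *)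
have [V00|V00] := eqVneq V 0%R.
  rewrite WE V00 mulr0 !mul0r integral0_eq// => th _.
  by rewrite /F /= wE V00 mulr0 mul0r mulr0.
have tj1 : (scoord 1 t j <= 1)%R.
  rewrite -[leRHS](sum_scoord 1 t) (bigD1 j)//= lerDl sumr_ge0// => i ij.
  have /prodf_neq0 /(_ i ij) := V00.
  by rewrite /pospow; case: ifP => //; rewrite eqxx.
transitivity ((V * g t)%:E * \int[leb]_(th in I) (pospow (a j) (scoord 1 t j - th))%:E).
  rewrite [in RHS]integral_mkcond -ge0_integralZl//.
  - apply: eq_integral => th _; rewrite /F /= wE patchE indicE.
    by case: ifP => _; rewrite ?mul0r ?mule0// mul1r -EFinM; congr EFin; ring.
  - apply/(measurable_restrictT _ _).1/measurable_funTS => //.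
    apply/measurable_EFinP; apply: (measurableT_comp (measurable_pospow _)).
    exact: measurable_funB.
  - by move=> x _; apply: erestrict_ge0 => th _; rewrite lee_fin pospow_ge0.
  - by rewrite lee_fin mulr_ge0.
rewrite integral_pospow_sub// -pospow_mulr// WE -EFinM; congr EFin.
by field; rewrite gt_eqF.
Qed.

Lemma simplex_weight_eq0 t : ~ simplex t -> simplex_weight a 1 t = 0%R.
Proof.
move=> /existsNP[i /negP ti].
by apply/eqP/prodf_eq0; exists i => //; rewrite /pospow (negbTE ti).
Qed.

Lemma simplex_weight_scoord_ge0 t i : (0 <= simplex_weight a 1 t * scoord 1 t i)%R.
Proof.
have [tS|tS] := pselect (simplex t).
  by rewrite mulr_ge0 ?simplex_weight_ge0//; exact: tS.
by rewrite simplex_weight_eq0// mul0r.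
Qed.

Lemma measurable_toward_vertex (j : 'I_n.+1) :
  measurable_fun setT (fun z : measurableTypeR R * n.-tuple R => toward_vertex j z.1 z.2).
Proof.
apply/measurable_fun_tnthP => i.
rewrite (_ : _ \o _ = fun z : measurableTypeR R * n.-tuple R => ((1 - z.1) * tnth z.2 i +
    (if i == j :> nat then z.1 else 0))%R); last first.
  by apply/funext => z /=; rewrite tnth_mktuple.
apply: measurable_funD.
  apply: measurable_funM.
    by apply: measurable_funB => //; exact: measurable_fst.
  by apply: (measurableT_comp (measurable_tnth i)); exact: measurable_snd.
by case: (i == j :> nat); [exact: measurable_fst|exact: measurable_cst].
Qed.

Lemma mix_simplex_point (j : 'I_n.+1) (th : R) t (A : set 'I_n.+1) :
  (0 <= th <= 1)%R -> simplex t ->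
  pmix ((th : measurableTypeR R, j), simplex_point t) A =
  simplex_point (toward_vertex j th t) A.
Proof.
move=> th01 tS; have /andP[th0 th1] := th01.
have tS' : simplex (toward_vertex j th t).
  move=> i; rewrite scoord_toward_vertex; apply: addr_ge0; last by case: ifP.
  by apply: mulr_ge0; [rewrite subr_ge0|exact: tS].
rewrite [LHS]mixE /= clip_id// !simplex_pointE//.
rewrite ge0_sume_distrr; last by move=> i _; rewrite mule_ge0// lee_fin; exact: tS.
under [RHS]eq_bigr => i _.
  rewrite scoord_toward_vertex EFinD ge0_muleDl; last 2 first.
  - by rewrite lee_fin; apply: mulr_ge0; [rewrite subr_ge0|exact: tS].
  - by case: ifP; rewrite lee_fin.
  over.
rewrite big_split /= addeC; congr (_ + _).
  by apply: eq_bigr => i _; rewrite EFinM muleA.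
by rewrite [RHS](bigD1 j)//= eqxx big1 ?adde0// => i /negbTE ->; rewrite mul0e.
Qed.

Lemma dirichlet_pos_fixpoint (alpha : Mstar 'I_n.+1 R) :
  (forall i, fine (alpha [set i]) = a i) ->
  stick_fixpoint (base_law alpha) dirichlet_pos_law.
Proof.
move=> alphaE U mU; set Q := dirichlet_pos_law.
have alpha1 i : alpha [set i] = (a i)%:E by rewrite -alphaE fineK// fin_num_measure.
have massE : total_mass alpha = (\sum_i a i)%R.
  suff aT : alpha setT = (\sum_i a i)%:E by rewrite /total_mass aT.
  rewrite [LHS]measure_ordE -sumEFin; apply: eq_bigr => i _.
  by rewrite diracT mule1; exact: alpha1.
pose V : set ((measurableTypeR R * 'I_n.+1) * pprobability 'I_n.+1 R) := @pmix _ _ R @^-1` U.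
have mV : measurable V by rewrite -[V]setTI; exact: measurable_pmix.
pose G (y : measurableTypeR R * 'I_n.+1) : \bar R := Q (xsection V y).
have mG : measurable_fun setT G by exact: measurable_fun_xsection.
pose g t : R := \1_U (simplex_point t).
have g0 t : (0 <= g t)%R by [].
have mg : measurable_fun setT g.
  have m1U : measurable_fun setT (\1_U : pprobability 'I_n.+1 R -> R).
    exact: measurable_indic.
  exact: (measurableT_comp m1U (@measurable_simplex_point R n)).
pose L (th : measurableTypeR R) j : \bar R :=
  \int[lebn]_t (simplex_weight a 1 t * g (toward_vertex j th t))%:E.
have L0 th j : 0 <= L th j.
  by apply: integral_ge0 => t _; rewrite lee_fin mulr_ge0 ?simplex_weight_ge0.
have mL j : measurable_fun setT (L ^~ j).
  pose F (z : measurableTypeR R * n.-tuple R) : \bar R :=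
    (simplex_weight a 1 z.2 * g (toward_vertex j z.1 z.2))%:E.
  apply: (@measurable_fun_fubini_tonelli_F _ _ _ _ _ lebn F).
    apply/measurable_EFinP; apply: measurable_funM.
      apply: (measurableT_comp (measurable_simplex_weight1 a 1)).
      exact: measurable_snd.
    exact: (measurableT_comp mg (measurable_toward_vertex j)).
  by move=> z; rewrite lee_fin mulr_ge0 ?simplex_weight_ge0.
have K0 := ltW dirichlet_cst_gt0.
(* Lengths in ]0, 1[ suffice, as the stick density vanishes elsewhere; for these, mixing a simplex
   point with a vertex stays in the simplex. *)
have GE th j : (0 < th < 1)%R -> G (th, j) = dirichlet_cst%:E * L th j.
  move=> /andP[th0 th1]; rewrite /G [LHS]dirichlet_pos_lawE; last exact: measurable_xsection.
  rewrite /L -ge0_integralZl//; last 2 first.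
  - apply/measurable_EFinP/measurable_funM; first exact: measurable_simplex_weight1.
    by apply: (measurableT_comp mg); exact: measurable_tuple_affine.
  - by move=> t _; rewrite lee_fin mulr_ge0 ?simplex_weight_ge0.
  apply: eq_integral => t _; rewrite -EFinM /dirichlet_weight -mulrA.
  have [tS|tS] := pselect (simplex t); last by rewrite simplex_weight_eq0// !mul0r.
  congr (_ * (_ * _))%:E; rewrite /g !indicE; congr ((nat_of_bool _)%:R).
  have E := mix_simplex_point j _ _ tS.
  rewrite mem_xsection; apply/idP/idP; rewrite !inE => H.
    by apply: pprobability_saturated H => // A _; rewrite E ?ltW.
  by apply: pprobability_saturated H => // A _; rewrite E ?ltW.
rewrite [LHS]dirichlet_pos_lawE//.
transitivity (\int[base_law alpha]_y G y); last first.
  apply: eq_integral => y _; congr (Q _).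
  by apply/seteqP; split => P; rewrite /xsection /= inE.
rewrite ge0_integral_base_law//.
transitivity (\int[leb]_th \sum_(j < n.+1) ((a j * dirichlet_cst)%:E *
    ((stick_density (\sum_i a i) th)%:E * L th j))); last first.
  apply: eq_integral => th _; rewrite ge0_integral_ord// massE.
  rewrite ge0_sume_distrr; last by move=> j _; rewrite mule_ge0.
  apply: eq_bigr => j _; rewrite [X in _ = _ * (X * _)]alpha1.
  have [th01|th01] := boolP (0 < th < 1)%R.
    by rewrite GE// EFinM muleCA -!muleA.
  rewrite /stick_density indicE memNset ?mul0r ?mul0e ?mule0//= in_itv /=.
  exact/negP.
have sd0 (th : R) : 0 <= (stick_density (\sum_i a i) th)%:E.
  by rewrite lee_fin stick_density_ge0.
have msd : measurable_fun setT (fun th : measurableTypeR R =>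
    (stick_density (\sum_i a i) th)%:E).
  by apply/measurable_EFinP; exact: measurable_stick_density1.
rewrite ge0_integral_sum//; last 2 first.
- by move=> j; apply: measurable_funeM; exact: emeasurable_funM.
- by move=> j th _; rewrite !mule_ge0// lee_fin mulr_ge0// ltW.
(* The factor sum_j x_j = 1 is inserted into the density. Term by term, the weight a_j of vertex [j]
   then cancels the 1 / a_j left by the integration over theta. *)
transitivity (\sum_(j < n.+1) \int[lebn]_t
    (dirichlet_cst * (simplex_weight a 1 t * scoord 1 t j) * g t)%:E).
  rewrite -ge0_integral_sum//.
  - apply: eq_integral => t _; rewrite sumEFin; congr EFin.
    by rewrite -mulr_suml -mulr_sumr -mulr_sumr sum_scoord mulr1.
  - move=> j; apply/measurable_EFinP/measurable_funM => //; apply: measurable_funM => //.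
    by apply: measurable_funM; [exact: measurable_simplex_weight1|exact: measurable_scoord1].
  - by move=> j t _; rewrite lee_fin mulr_ge0// mulr_ge0// simplex_weight_scoord_ge0.
apply: eq_bigr => j _.
rewrite ge0_integralZl//; last 3 first.
- exact: emeasurable_funM.
- by move=> th _; rewrite mule_ge0.
- by rewrite lee_fin mulr_ge0// ltW.
rewrite dirichlet_pos_law_step// -ge0_integralZl//.
- apply: eq_integral => t _; rewrite -EFinM; congr EFin.
  by field; rewrite gt_eqF.
- apply/measurable_EFinP/measurable_funM => //; apply: measurable_funM.
    exact: measurable_simplex_weight1.
  by apply: measurable_funM => //; exact: measurable_scoord1.
- move=> t _; rewrite lee_fin mulr_ge0// mulrA mulr_ge0 ?simplex_weight_scoord_ge0//.
  by rewrite invr_ge0 ltW.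
- by rewrite lee_fin mulr_ge0// ltW.
Qed.

End positive_dirichlet.

(** * The finite-dimensional distributions *)

(** The base laws of the two parameters have the same integrals, so the Dirichlet law of one solves
    the equation of the other, and uniqueness applies. *)
Lemma dirichlet_law_ext d (X : measurableType d) (R : realType)
    (alpha beta : Mstar X R) :
  (forall A, measurable A -> alpha A = beta A) ->
  forall U : set (pprobability X R), measurable U ->
    dirichlet_law alpha U = dirichlet_law beta U.
Proof.
move=> ab; apply: dirichlet_law_unique.
have : stick_fixpoint (base_law beta) (dirichlet_law beta) by exact: stick_lawP.
move: (dirichlet_law beta) => Q.
move=> fQ U mU.
rewrite [LHS](fQ U mU).
pose V : set ((measurableTypeR R * X) * pprobability X R) := @pmix _ _ R @^-1` U.
have mV : measurable V by rewrite -[V]setTI; exact: measurable_pmix.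
pose G (y : measurableTypeR R * X) : \bar R := Q (xsection V y).
have mG : measurable_fun setT G by exact: measurable_fun_xsection.
have GE y : Q [set P | U (mix y P : pprobability X R)] = G y.
  by congr (Q _); apply/seteqP; split => P; rewrite /xsection /= inE.
transitivity (\int[base_law beta]_y G y)%E.
  by apply: eq_integral => y _; rewrite -GE.
transitivity (\int[base_law alpha]_y G y)%E; last first.
  by apply: eq_integral => y _; rewrite -GE.
rewrite [LHS]ge0_integral_base_law// [RHS]ge0_integral_base_law//.
rewrite (_ : total_mass alpha = total_mass beta); last by rewrite /total_mass ab.
apply: eq_integral => t _; congr (_ * _)%E.
by apply: eq_measure_integral => A mA _; exact/esym/ab.
Qed.

Section support.
Context (R : realType) (k : nat) (beta : Mstar 'I_k.+1 R).

Let b (j : 'I_k.+1) : R := fine (beta [set j]).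
Notation S := (dirichlet_supp b).

Let beta1 j : beta [set j] = (b j)%:E.
Proof. by rewrite /b fineK// fin_num_measure. Qed.

Let b_ge0 j : 0 <= b j.
Proof. by rewrite /b fine_ge0. Qed.

Let card_supp : (#|S|.-1.+1 = #|S|)%N.
Proof.
apply: prednK; rewrite card_gt0; apply/eqP => S0.
have := @nzfinite_neq0 _ _ _ beta; apply.
rewrite [LHS]measure_ordE big1// => j _.
have : j \notin S by rewrite S0 inE.
by rewrite inE negbK => /eqP bj; rewrite [X in (X * _)%E]beta1 bj mul0e.
Qed.

(** A left inverse of the inclusion of the support. A point outside the support has an index out of
    range, which [inord] sends to the first point; it carries no mass. *)
Definition supp_retract (j : 'I_k.+1) : 'I_(#|S|.-1).+1 := inord (index j (enum S)).

HB.instance Definition _ := isMeasurableFun.Build _ _ _ _ supp_retract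
  (fun _ _ _ => I).

Lemma supp_retractK i : supp_retract (dirichlet_incl i) = i.
Proof.
rewrite /supp_retract /dirichlet_incl index_uniq ?enum_uniq ?inord_val//.
by rewrite -cardE -[ltnRHS]card_supp.
Qed.

Lemma dirichlet_inclK j : j \in S -> dirichlet_incl (supp_retract j) = j.
Proof.
move=> jS; rewrite /supp_retract /dirichlet_incl inordK ?nth_index ?mem_enum//.
by rewrite card_supp cardE index_mem mem_enum.
Qed.

Lemma dirichlet_incl_supp i : dirichlet_incl (alpha := b) i \in S.
Proof. by rewrite -mem_enum mem_nth// -cardE -[ltnRHS]card_supp. Qed.

(** Retraction onto the support makes all parameters positive, where the classical law is the fixed
    point; naturality along the inclusion carries the identity back. *)
Lemma dirichlet_law_finite (U : set (pprobability 'I_k.+1 R)) : measurable U ->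
  dirichlet_law beta U = dirichlet b U.
Proof.
move=> mU; pose gamma := M_map supp_retract beta.
have null j : j \notin S -> beta [set j] = 0%E.
  by rewrite inE negbK => /eqP bj; rewrite beta1 bj.
have a0 i : 0 < (b \o @dirichlet_incl R k b) i.
  by have := dirichlet_incl_supp i; rewrite inE /= lt_neqAle eq_sym b_ge0 andbT.
have gammaE i : fine (gamma [set i]) = (b \o @dirichlet_incl R k b) i.
  rewrite [X in fine X](_ : _ = beta (supp_retract @^-1` [set i]))//.
  congr fine; rewrite [LHS]measure_ordE (bigD1 (dirichlet_incl i))//= big1 ?adde0.
    by rewrite diracE mem_set ?mule1//= supp_retractK.
  move=> j ji; have [jS|/null ->] := boolP (j \in S); last by rewrite mul0e.
  rewrite diracE memNset ?mule0//= => ij.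
  by rewrite -ij dirichlet_inclK// eqxx in ji.
have mU' : measurable (P_map (R := R) (@dirichlet_incl R k b) @^-1` U).
  by have := measurable_P_map (@dirichlet_incl R k b) measurableT mU; rewrite setTI.
(* Retraction followed by inclusion fixes the support, and [beta] vanishes elsewhere, so the image
   of [gamma] agrees with [beta]. *)
rewrite (@dirichlet_law_ext _ _ _ _ (M_map (@dirichlet_incl R k b) gamma))//.
  rewrite dirichlet_law_natural// [LHS](_ : _ = dirichlet_law gamma
    (P_map (R := R) (@dirichlet_incl R k b) @^-1` U))//.
  rewrite (dirichlet_law_unique (dirichlet_pos_fixpoint a0 gammaE))//.
  by rewrite -dirichlet_posE.
move=> A _.
rewrite [RHS](_ : _ = beta ((@dirichlet_incl R k b \o supp_retract) @^-1` A))//.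
rewrite [LHS]measure_ordE [RHS]measure_ordE; apply: eq_bigr => j _.
have [jS|nS] := boolP (j \in S); last first.
  by rewrite [X in (X * _)%E = _](null j nS) [X in _ = (X * _)%E](null j nS) !mul0e.
by rewrite !diracE; congr (_ * (nat_of_bool _)%:R%:E)%E;
  apply/idP/idP; rewrite !inE /= dirichlet_inclK.
Qed.

End support.

Theorem theorem4 (R : realType) :
  exists D : forall (d : measure_display) (X : measurableType d),
      Mstar X R -> pprobability (pprobability X R) R,
    (forall (d : measure_display) (X : measurableType d),
       measurable_fun [set: Mstar X R] (D d X) /\
       forall alpha : Mstar X R, is_dirichlet_measure alpha (D d X alpha)) /\
    (forall (d d' : measure_display) (X : measurableType d)
       (Y : measurableType d') (kappa : {mfun X >-> Y}) (alpha : Mstar X R),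
       measure_eq (D d' Y (M_map kappa alpha)) (P2_map kappa (D d X alpha))).
Proof.
exists (fun d X => @dirichlet_law d X R); split=> [d X|d d' X Y kappa alpha U mU].
  split=> [|alpha k p _ A mA]; first exact: measurable_dirichlet_law.
  (* Naturality along [p] moves the claim to the finite sample space, with the image of [alpha] as
     parameter. *)
  by rewrite -dirichlet_law_natural// dirichlet_law_finite.
exact: dirichlet_law_natural.
Qed.
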